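(* Let $S$ be a PAInv-submanifold of a Kenmotsu manifold $\bar M$, with ambiguous distribution $\mathfrak D$ and anti-invariant distribution $\mathfrak D^\perp$. Then the distribution $\mathfrak D\oplus\langle\xi\rangle$ is integrable if and only if $$h(Y_1,TY_2)-h(Y_2,TY_1)+\nabla^\perp_{Y_1}NY_2-\nabla^\perp_{Y_2}NY_1\in\Gamma(N\mathfrak D\oplus\mu)$$ for all $Y_1,Y_2\in\Gamma(\mathfrak D\oplus\langle\xi\rangle)$.
   Context: An almost contact metric manifold $(\bar M,\phi,\xi,\eta,g)$ is a Riemannian manifold $(\bar M,g)$ of dimension $2n+1$ with a $(1,1)$-tensor field $\phi$, a vector field $\xi$ and a 1-form $\eta$ such that $\phi^2=-I+\eta\otimes\xi$, $\eta(\xi)=1$, $\phi\xi=0$, $\eta\circ\phi=0$ and $g(\phi X,\phi Y)=g(X,Y)-\eta(X)\eta(Y)$. It is a Kenmotsu manifold if its Levi-Civita connection $\bar\nabla$ satisfies $(\bar\nabla_X\phi)Y=g(\phi X,Y)\xi-\eta(Y)\phi X$ (hence $\bar\nabla_X\xi=X-\eta(X)\xi$). Let $S$ be an immersed submanifold of $\bar M$ with $\xi$ tangent to $S$. For $X$ tangent to $S$ write $\phi X=TX+NX$ with $TX$ tangent and $NX$ normal to $S$. $S$ is a PAInv-submanifold (partially anti-invariant submanifold) if there are mutually orthogonal distributions $\mathfrak D$ (the ambiguous distribution) and $\mathfrak D^\perp$ on $S$ with orthogonal decomposition $TS=\mathfrak D\oplus\mathfrak D^\perp\oplus\langle\xi\rangle$,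 $\phi\mathfrak D^\perp\subseteq TS^\perp$ ($\mathfrak D^\perp$ is anti-invariant) and $T\mathfrak D\subseteq\mathfrak D$. The normal bundle decomposes orthogonally as $TS^\perp=\phi\mathfrak D^\perp\oplus N\mathfrak D\oplus\mu$, where $\mu$ is the orthogonal complementary subbundle of $\phi\mathfrak D^\perp\oplus N\mathfrak D$. $h$ denotes the second fundamental form of $S$ and $\nabla^\perp$ its normal connection. *)

(* Defs.v *)
(* MathComp-Analysis. Vectors are rows: a linear map with matrix A sends v to
   v *m A, and a subspace is the row space of a matrix, as in mxalgebra. *)
From HB Require Import structures.
From mathcomp Require Export all_boot all_order all_algebra.
From mathcomp Require Export boolp classical_sets functions cardinality reals.
From mathcomp Require Export topology normedtype derive.
Export Order.TTheory GRing.Theory Num.Theory numFieldNormedType.Exports.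

#[export] Set Implicit Arguments.
#[export] Unset Strict Implicit.
#[export] Unset Printing Implicit Defensive.

Open Scope classical_set_scope.
Open Scope ring_scope.

(** * Smooth maps between normed spaces *)

Fixpoint Ck (R : realType) (V W : normedModType R) (k : nat) (U : set V)
    (f : V -> W) : Prop :=
  match k with
  | 0 => forall x, U x -> {for x, continuous f}
  | k'.+1 => (forall x, U x -> differentiable f x) /\
             (forall v, Ck k' U (fun x => 'd f x v))
  end.

Definition smooth_on (R : realType) (V W : normedModType R) (U : set V)
  (f : V -> W) : Prop := forall k, Ck k U f.

(* Smooth on some neighbourhood of x. *)
Definition smooth_at (R : realType) (V W : normedModType R) (x : V)
  (f : V -> W) : Prop := exists2 U, open_nbhs x U & smooth_on U f.

(** * Smooth manifolds *)

(* The values of [coord] off [cdom] and of [cinv] off [coord @` cdom] are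
   irrelevant. *)
Record chart (R : realType) (T : topologicalType) (n : nat) := Chart {
  cdom : set T;
  coord : T -> 'rV[R]_n;
  cinv : 'rV[R]_n -> T;
  cdom_open : open cdom;
  cimg_open : open (coord @` cdom);
  coordK : forall q, cdom q -> cinv (coord q) = q;
  coord_continuous : forall q, cdom q -> {for q, continuous coord};
  cinv_continuous : forall x, (coord @` cdom) x -> {for x, continuous cinv}
}.

Definition transition (R : realType) (T : topologicalType) (n : nat)
    (c c' : chart R T n) : 'rV[R]_n -> 'rV[R]_n := coord c' \o cinv c.

(* [chart_at p] is a chosen chart of the atlas around p. Throughout, the tangent
   space at p is 'rV[R]_n, a row being the components of a tangent vector in
   the coordinate basis of [chart_at p]. *)
Record manifold (R : realType) (n : nat) := Manifold {
  carrier :> topologicalType;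
  manifold_hausdorff : hausdorff_space carrier;
  manifold_second_countable : @second_countable carrier;
  atlas : set (chart R carrier n);
  atlas_smooth : forall c c', atlas c -> atlas c' ->
    smooth_on (coord c @` (cdom c `&` cdom c')) (transition c c');
  chart_at : carrier -> chart R carrier n;
  chart_at_atlas : forall p, atlas (chart_at p);
  chart_at_cdom : forall p, cdom (chart_at p) p
}.

Definition coord_at (R : realType) (n : nat) (M : manifold R n) (p : M) :
  'rV[R]_n := coord (chart_at p) p.

(* Matrix of the change of components at q from the basis of [chart_at x] to the basis of
   [chart_at y]. *)
Definition tchange (R : realType) (n : nat) (M : manifold R n) (x y q : M) :
    'M[R]_n :=
  jacobian (transition (chart_at x) (chart_at y)) (coord (chart_at x) q).

Section Maps.
Variables (R : realType) (m n : nat) (S : manifold R m) (M : manifold R n).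

Definition smooth_fun_at (W : normedModType R) (p : S) (u : S -> W) : Prop :=
  smooth_at (coord_at p) (u \o cinv (chart_at p)).

Definition deriv (W : normedModType R) (u : S -> W) (p : S) (v : 'rV[R]_m) : W :=
  'd (u \o cinv (chart_at p)) (coord_at p) v.

Definition smooth_map (f : S -> M) : Prop :=
  continuous f /\ forall p, smooth_fun_at p (coord (chart_at (f p)) \o f).

Definition dmap (f : S -> M) (p : S) : 'M[R]_(m, n) :=
  jacobian (coord (chart_at (f p)) \o f \o cinv (chart_at p)) (coord_at p).

Definition immersion (f : S -> M) : Prop :=
  smooth_map f /\ forall p, row_free (dmap f p).

(* A vector field along f assigns to p a tangent vector of M at f p;
   a vector field on M is a vector field along idfun. *)

(* The components of V near p in the coordinate basis of [chart_at (f p)]. *)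
Definition components (f : S -> M) (p : S) (V : S -> 'rV[R]_n) (q : S) :
  'rV[R]_n := V q *m tchange (f q) (f p) (f q).

Definition smooth_field_at (f : S -> M) (p : S) (V : S -> 'rV[R]_n) : Prop :=
  smooth_fun_at p (components f p V).

(* V is a smooth section of the field E of subspaces along f. *)
Definition is_section (k : nat) (f : S -> M) (E : S -> 'M[R]_(k, n))
    (V : S -> 'rV[R]_n) : Prop :=
  (forall p, smooth_field_at f p V) /\ (forall p, (V p <= E p)%MS).

Definition push (f : S -> M) (X : S -> 'rV[R]_m) (p : S) : 'rV[R]_n :=
  X p *m dmap f p.

End Maps.

Section Manifold.
Variables (R : realType) (n : nat) (M : manifold R n).
Implicit Types X Y : M -> 'rV[R]_n.

Definition bracket X Y (p : M) : 'rV[R]_n :=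
  deriv (components idfun p Y) p (X p) - deriv (components idfun p X) p (Y p).

(* A smooth subbundle of the tangent bundle: constant rank, with smooth frames
   around each point. *)
Definition is_distribution (D : M -> 'M[R]_n) : Prop :=
  exists d : nat, (forall p, \rank (D p) = d) /\
    forall p, exists E : M -> 'M[R]_(d, n),
      (forall i, smooth_field_at idfun p (fun q => row i (E q))) /\
      \forall q \near p, (D q :=: E q)%MS.

(* Integrability in the sense customary for distributions on submanifolds: the
   module of smooth sections is closed under the Lie bracket. *)
Definition integrable_distribution (D : M -> 'M[R]_n) : Prop :=
  forall X Y, is_section idfun D X -> is_section idfun D Y ->
    is_section idfun D (bracket X Y).

(** * Riemannian metrics and connections *)

Definition ip (G : 'M[R]_n) (u v : 'rV[R]_n) : R := (u *m G *m v^T) 0 0.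

Definition riemannian_metric (g : M -> 'M[R]_n) : Prop :=
  [/\ forall p u v, ip (g p) u v = ip (g p) v u,
      forall p u, u != 0 -> 0 < ip (g p) u u
    & forall p X Y, smooth_field_at idfun p X -> smooth_field_at idfun p Y ->
        smooth_fun_at p (fun q => ip (g q) (X q) (Y q) : R^o)].

(* [nabla p v Y] is the derivative of Y at p along the tangent vector v. It is
   meaningful for Y smooth near p: nabla acts on local sections, and the Leibniz
   rule with u = 0 near p shows that it depends only on the germ of Y. *)
Definition affine_connection
    (nabla : forall p : M, 'rV[R]_n -> (M -> 'rV[R]_n) -> 'rV[R]_n) : Prop :=
  [/\ forall p a v w Y, smooth_field_at idfun p Y ->
        nabla p (a *: v + w) Y = a *: nabla p v Y + nabla p w Y,
      forall p v Y Z, smooth_field_at idfun p Y -> smooth_field_at idfun p Z ->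
        nabla p v (fun q => Y q + Z q) = nabla p v Y + nabla p v Z,
      forall p v (u : M -> R^o) Y, smooth_fun_at p u -> smooth_field_at idfun p Y ->
        nabla p v (fun q => u q *: Y q) = deriv u p v *: Y p + u p *: nabla p v Y
    & forall p X Y, smooth_field_at idfun p X -> smooth_field_at idfun p Y ->
        smooth_field_at idfun p (fun q => nabla q (X q) Y)].

Definition levi_civita (g : M -> 'M[R]_n)
    (nabla : forall p : M, 'rV[R]_n -> (M -> 'rV[R]_n) -> 'rV[R]_n) : Prop :=
  [/\ affine_connection nabla,
      forall p X Y, smooth_field_at idfun p X -> smooth_field_at idfun p Y ->
        nabla p (X p) Y - nabla p (Y p) X = bracket X Y p
    & forall p v X Y, smooth_field_at idfun p X -> smooth_field_at idfun p Y ->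
        deriv (fun q => ip (g q) (X q) (Y q) : R^o) p v =
        ip (g p) (nabla p v X) (Y p) + ip (g p) (X p) (nabla p v Y)].

(* The k-th coordinate field of [chart_at x]. *)
Definition coord_field (x : M) (k : 'I_n) (q : M) : 'rV[R]_n :=
  row k (tchange x q q).

(** * Almost contact metric and Kenmotsu structures *)

Definition covec (a : 'cV[R]_n) (v : 'rV[R]_n) : R := (v *m a) 0 0.

Definition almost_contact_metric (g phi : M -> 'M[R]_n) (xi : M -> 'rV[R]_n)
    (eta : M -> 'cV[R]_n) : Prop :=
  [/\ riemannian_metric g,
      [/\ forall p X, smooth_field_at idfun p X ->
            smooth_field_at idfun p (fun q => X q *m phi q),
          forall p, smooth_field_at idfun p xi
        & forall p X, smooth_field_at idfun p X ->
            smooth_fun_at p (fun q => covec (eta q) (X q) : R^o)]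
    & forall p,
      [/\ forall v, v *m phi p *m phi p = - v + covec (eta p) v *: xi p,
          covec (eta p) (xi p) = 1,
          xi p *m phi p = 0,
          forall v, covec (eta p) (v *m phi p) = 0
        & forall u v, ip (g p) (u *m phi p) (v *m phi p) =
            ip (g p) u v - covec (eta p) u * covec (eta p) v]].

Definition kenmotsu (g phi : M -> 'M[R]_n) (xi : M -> 'rV[R]_n)
    (eta : M -> 'cV[R]_n)
    (nabla : forall p : M, 'rV[R]_n -> (M -> 'rV[R]_n) -> 'rV[R]_n) : Prop :=
  [/\ almost_contact_metric g phi xi eta,
      levi_civita g nabla
    & forall p v Y, smooth_field_at idfun p Y ->
        nabla p v (fun q => Y q *m phi q) - nabla p v Y *m phi p =
        ip (g p) (v *m phi p) (Y p) *: xi p - covec (eta p) (Y p) *: (v *m phi p)].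

End Manifold.

(** * Submanifolds *)

Section Submanifold.
Variables (R : realType) (m n : nat) (S : manifold R m) (M : manifold R n).
Variables (g phi : M -> 'M[R]_n) (xi : M -> 'rV[R]_n).
Variable (nabla : forall p : M, 'rV[R]_n -> (M -> 'rV[R]_n) -> 'rV[R]_n).
Variable (f : S -> M).
Implicit Types (X Y : S -> 'rV[R]_m) (V : S -> 'rV[R]_n) (D : S -> 'M[R]_m).

(* The connection induced on vector fields along f: for V = sum_k V^k e_k with
   e_k the coordinate fields of the chart at f p,
   nabla_v V = sum_k (v(V^k) e_k + V^k nabla_(df v) e_k). *)
Definition nabla_along (p : S) (v : 'rV[R]_m) V : 'rV[R]_n :=
  deriv (components f p V) p v +
  \sum_(k < n) components f p V p 0 k *:
     nabla (f p) (v *m dmap f p) (coord_field (f p) k).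

Definition normal_space (p : S) : 'M[R]_n := kermx (g (f p) *m (dmap f p)^T).

Definition tan_proj (p : S) : 'M[R]_n :=
  proj_mx <<dmap f p>>%MS (normal_space p).

Definition nor_proj (p : S) : 'M[R]_n :=
  proj_mx (normal_space p) <<dmap f p>>%MS.

Definition second_fundamental_form X Y (p : S) : 'rV[R]_n :=
  nabla_along p (X p) (push f Y) *m nor_proj p.

Definition normal_connection X V (p : S) : 'rV[R]_n :=
  nabla_along p (X p) V *m nor_proj p.

(* w |-> the tangent vector of S whose image under df is the tangential part
   of w. *)
Definition tan_coord (p : S) : 'M[R]_(n, m) := tan_proj p *m pinvmx (dmap f p).

(* phi X = TX + NX, with TX in the tangent space of S; [Tmx] and [Nmx] are the
   matrices of T and N. *)
Definition Tmx (p : S) : 'M[R]_m :=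
  dmap f p *m phi (f p) *m tan_coord p.

Definition Nmx (p : S) : 'M[R]_(m, n) := dmap f p *m phi (f p) *m nor_proj p.

Definition Tpart X (p : S) : 'rV[R]_m := X p *m Tmx p.

Definition Npart X (p : S) : 'rV[R]_n := X p *m Nmx p.

(* xi as a vector field on S; used when xi is tangent to S. *)
Definition xi_tan (p : S) : 'rV[R]_m := xi (f p) *m tan_coord p.

Definition orthogonal_distr (k l : nat) (A : S -> 'M[R]_(k, m))
    (B : S -> 'M[R]_(l, m)) : Prop :=
  forall p (u v : 'rV[R]_m), (u <= A p)%MS -> (v <= B p)%MS ->
    ip (g (f p)) (u *m dmap f p) (v *m dmap f p) = 0.

(* S, immersed by f, is a PAInv-submanifold with ambiguous distribution D and
   anti-invariant distribution D'. *)
Definition PAInv_submanifold D (D' : S -> 'M[R]_m) : Prop :=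
  [/\ immersion f,
      forall p, (xi (f p) <= dmap f p)%MS,
      is_distribution D /\ is_distribution D',
      [/\ orthogonal_distr D D', orthogonal_distr D xi_tan,
          orthogonal_distr D' xi_tan
        & forall p, (D p + D' p + xi_tan p :=: 1%:M)%MS]
    & forall p, (D' p *m dmap f p *m phi (f p) <= normal_space p)%MS /\
                (D p *m Tmx p <= D p)%MS].

Definition D_plus_xi D (p : S) : 'M[R]_m := (D p + xi_tan p)%MS.

Definition phi_distr (D' : S -> 'M[R]_m) (p : S) : 'M[R]_(m, n) :=
  D' p *m dmap f p *m phi (f p).

Definition N_distr D (p : S) : 'M[R]_(m, n) := D p *m Nmx p.

(* The orthogonal complement of phi D' + N D in the normal bundle. *)
Definition mu_bundle D (D' : S -> 'M[R]_m) (p : S) : 'M[R]_n :=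
  (normal_space p :&:
     kermx (g (f p) *m (phi_distr D' p + N_distr D p)%MS^T))%MS.

Definition ND_plus_mu D (D' : S -> 'M[R]_m) (p : S) : 'M[R]_n :=
  (N_distr D p + mu_bundle D D' p)%MS.

End Submanifold.

(* Main.v *)
From HB Require Import structures.
Require Import Defs.
From mathcomp Require Import landau ring lra.

(** Write N for the normal part of phi, [X, Y] for the bracket on S, and let the
    Levi-Civita connection act on fields along the immersion f. Differentiating
    phi (f_* Y) = f_* (T Y) + N Y along X, the Kenmotsu identity gives
    nabla_X (phi f_* Y) = phi (nabla_X f_* Y) + g(phi X, Y) xi - eta(Y) phi X.
    Since xi is tangent to S, the normal part of this equation reads
    h(X, T Y) + nabla^perp_X N Y = nor (phi (nabla_X f_* Y)) - eta(Y) N X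
    ([gauss_weingarten]). Antisymmetrize in X and Y: torsion-freeness replaces
    nabla_X f_* Y - nabla_Y f_* X by f_* [X, Y], so that the form in the theorem
    equals N [X, Y] - eta(Y) N X + eta(X) N Y ([integrability_formE]).

    For sections X, Y of D + <xi> the last two terms lie in N D because
    N xi = 0. Hence the form lies in N D + mu if and only if N [X, Y] does, and
    there only the component b of [X, Y] in D^perp matters. As D^perp is
    anti-invariant, N b = phi b; this vector is orthogonal to N D and to mu and
    has the same length as b. So it lies in N D + mu only when b = 0, that is,
    when [X, Y] lies in D + <xi> ([anti_invariant_part_eq0],
    [sub_ND_plus_mu_bracket]). The equivalence thus holds at each point for each
    pair of sections.

    The rest of the work is to make this calculus available. Tangent vectors are
    rows of components in a chart that varies with the base point without any
    continuity, so smoothness of a field near p is always checked after a change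
    of components to the one chart chosen at p. Everything that is then needed
    from analysis is that smooth maps are stable under sums, products,
    composition and matrix inversion, and that second derivatives are symmetric.
    The latter enters once, in [commutator_push]: it makes the bracket both
    independent of the chart (hence smooth) and natural under f. The connection
    is carried to fields along f through its Christoffel-type expansion in a
    coordinate frame ([nabla_expand]), whose torsion vanishes
    ([coord_torsion_free]). *)

(** * Maps of class C^k on an open set *)

Section Germ.
Variables (R : realType) (V W : normedModType R).
Implicit Types f g : V -> W.

Lemma near_eq_diff f g x : (\forall y \near x, f y = g y) ->
  differentiable f x -> differentiable g x /\ 'd g x = 'd f x :> (V -> W).
Proof.
move=> fg df.
have [fc fo] := (diff_locallyP x f).1 df.
have gE : g \o shift x = cst (g x) + 'd f x +o_ 0 id.
  apply/eqaddoP => e e0; have /eqaddoP/(_ e e0) := fo.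
  have fgs : \forall h \near (0 : V), f (h + x) = g (h + x).
    by move: fg; rewrite (near_shift 0 x) /=; apply: filterS => h /=; rewrite subr0.
  apply: filterS2 fgs => h /= fgh.
  by rewrite !fctE /= -fgh (nbhs_singleton fg).
have dgE : 'd g x = 'd f x :> (V -> W) by apply: diff_unique.
by split; [apply/diff_locallyP; rewrite dgE; split; [exact: fc|exact: gE]|exact: dgE].
Qed.

Lemma Ck_congr k U f g : open U -> (forall x, U x -> f x = g x) ->
  Ck k U f -> Ck k U g.
Proof.
move=> oU; elim: k f g => [|k IH] f g fg /=.
  move=> fc x Ux.
  have nfg : \forall y \near x, f y = g y.
    by have := open_nbhs_nbhs (conj oU Ux); apply: filterS.
  have : f @ x --> f x by exact: fc.
  rewrite (fg _ Ux) => fx; apply: cvg_trans fx.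
  exact: near_eq_cvg.
move=> [fd fk].
have nfg x : U x -> \forall y \near x, f y = g y.
  by move=> Ux; have := open_nbhs_nbhs (conj oU Ux); apply: filterS.
split=> [x Ux|v]; first by have [] := near_eq_diff (nfg _ Ux) (fd _ Ux).
apply: IH (fk v) => x Ux.
exact/esym/(congr1 (@^~ v) (near_eq_diff (nfg _ Ux) (fd _ Ux)).2).
Qed.

Lemma Ck_sub k (U U' : set V) f : U' `<=` U -> Ck k U f -> Ck k U' f.
Proof.
move=> s; elim: k f => [|k IH] f /= => [fc x /s /fc //|[fd fk]].
by split=> [x /s /fd //|v]; apply: IH.
Qed.

Lemma CkS k (U : set V) f : Ck k.+1 U f -> Ck k U f.
Proof.
elim: k f => [|k IH] f [fd fk].
  by move=> x /fd /differentiable_continuous.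
by split=> // v; apply: IH; apply: fk.
Qed.

Lemma Ck_cst k (U : set V) (c : W) : Ck k U (fun=> c).
Proof.
elim: k c => [|k IH] c /=; first by move=> x _; exact: cst_continuous.
split=> [x _|v]; first exact: differentiable_cst.
suff -> : (fun x => 'd (fun=> c) x v) = (fun=> 0 : W) by exact: IH.
by apply/funext => x; exact: (congr1 (@^~ v) (diff_cst c x)).
Qed.

Lemma CkD k U f g : open U -> Ck k U f -> Ck k U g ->
  Ck k U (fun x => f x + g x).
Proof.
move=> oU; elim: k f g => [|k IH] f g /=.
  by move=> fc gc x Ux; apply: continuousD; [exact: fc|exact: gc].
move=> [fd fk] [gd gk]; split=> [x Ux|v].
  by apply: differentiableD; [exact: fd|exact: gd].
apply: Ck_congr (IH _ _ (fk v) (gk v)) => // x Ux.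
exact/esym/(congr1 (@^~ v) (diffD (fd _ Ux) (gd _ Ux))).
Qed.

Lemma Ck_sum k U (I : Type) (r : seq I) (f : I -> V -> W) : open U ->
  (forall i, Ck k U (f i)) -> Ck k U (fun x => \sum_(i <- r) f i x).
Proof.
move=> oU fk; elim: r => [|i r IH].
  by under eq_fun do rewrite big_nil; exact: Ck_cst.
under eq_fun do rewrite big_cons; exact: CkD.
Qed.

End Germ.

Section CkAlgebra.
Variables (R : realType) (V : normedModType R).

Lemma Ck_lin k (W W' : normedModType R) (L : {linear W -> W'}) U (f : V -> W) :
  open U -> continuous L -> Ck k U f -> Ck k U (fun x => L (f x)).
Proof.
move=> oU cL; elim: k f => [|k IH] f /=.
  by move=> fc x Ux; apply: (continuous_comp (fc _ Ux)); exact: cL.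
move=> [fd fk]; split=> [x Ux|v].
  by apply: differentiable_comp; [exact: fd|exact: linear_differentiable].
apply: Ck_congr (IH _ (fk v)) => // x Ux.
apply/esym; apply: etrans (congr1 (@^~ v) (diff_comp (fd _ Ux)
  (linear_differentiable (f x) cL))) _.
exact: (congr1 (@^~ ('d f x v)) (diff_lin (f x) cL)).
Qed.

Lemma CkM k U (f g : V -> R) : open U -> Ck k U f -> Ck k U g ->
  Ck k U (fun x => f x * g x).
Proof.
move=> oU; elim: k f g => [|k IH] f g.
  by move=> fc gc x Ux; apply: continuousM; [exact: fc|exact: gc].
move=> fS gS; have [fd fk] := fS; have [gd gk] := gS; split=> [x Ux|v].
  by apply: differentiableM; [exact: fd|exact: gd].
apply: (@Ck_congr _ _ _ _ _ (fun x => f x * 'd g x v + g x * 'd f x v)) => //.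
  by move=> x Ux; exact/esym/(congr1 (@^~ v) (diffM (fd _ Ux) (gd _ Ux))).
apply: CkD => //; apply: IH; [exact: CkS fS|exact: gk|exact: CkS gS|exact: fk].
Qed.

Lemma Ck_prod k U (I : Type) (r : seq I) (f : I -> V -> R) : open U ->
  (forall i, Ck k U (f i)) -> Ck k U (fun x => \prod_(i <- r) f i x).
Proof.
move=> oU fk; elim: r => [|i r IH].
  by under eq_fun do rewrite big_nil; exact: Ck_cst.
by under eq_fun do rewrite big_cons; exact: CkM.
Qed.

Lemma Ck_inv k U (f : V -> R) : open U -> (forall x, U x -> f x != 0) ->
  Ck k U f -> Ck k U (fun x => (f x)^-1).
Proof.
move=> oU f0; elim: k => [|k IH].
  by move=> fc x Ux; apply: continuousV; [exact: f0|exact: fc].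
move=> fS; have [fd fk] := fS; split=> [x Ux|v].
  by apply: differentiableV; [exact: fd|exact: f0].
apply: (@Ck_congr _ _ _ _ _ (fun x => (-1) * ((f x)^-1 * (f x)^-1) * 'd f x v)) => //.
  move=> x Ux; rewrite -invfM -expr2 mulN1r.
  exact/esym/(congr1 (@^~ v) (diffV (fd _ Ux) (f0 _ Ux))).
have fi := IH (CkS fS).
apply: (CkM oU _ (fk v)); apply: (CkM oU (Ck_cst _ _ _)); exact: (CkM oU fi fi).
Qed.

Lemma Ck_entry k U m n (f : V -> 'M[R]_(m, n)) i j : open U ->
  Ck k U f -> Ck k U (fun x => f x i j).
Proof.
move=> oU fk.
have L_lin : linear (fun A : 'M[R]_(m, n) => A i j) by move=> a u v; rewrite !mxE.
pose LM := GRing.isLinear.Build _ _ _ _ _ L_lin.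
pose L : {linear 'M[R]_(m, n) -> R} := HB.pack (fun A : 'M[R]_(m, n) => A i j) LM.
have cL : continuous L by exact: (@matrix_normedtype.coord_continuous R m n i j).
exact: (Ck_lin oU cL fk).
Qed.

Lemma Ck_mx k U m n (f : V -> 'M[R]_(m, n)) : open U ->
  (forall i j, Ck k U (fun x => f x i j)) -> Ck k U f.
Proof.
move=> oU fk.
rewrite (_ : f = fun x => \sum_i \sum_j (f x i j *: delta_mx i j)); last first.
  by apply/funext => x; exact: matrix_sum_delta.
apply: Ck_sum => // i; apply: Ck_sum => // j.
have L_lin : linear (fun a : R => a *: (delta_mx i j : 'M[R]_(m, n))).
  by move=> a u v; rewrite scalerDl scalerA.
pose LM := GRing.isLinear.Build _ _ _ _ _ L_lin.
pose L : {linear R -> 'M[R]_(m, n)} :=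
  HB.pack (fun a : R => a *: (delta_mx i j : 'M[R]_(m, n))) LM.
have cL : continuous L by exact: scalel_continuous.
exact: (Ck_lin oU cL (fk i j)).
Qed.

Lemma CkZ k U m n (u : V -> R) (f : V -> 'M[R]_(m, n)) : open U ->
  Ck k U u -> Ck k U f -> Ck k U (fun x => u x *: f x).
Proof.
move=> oU uk fk; apply: Ck_mx => // i j.
under eq_fun do rewrite mxE.
by apply: CkM => //; apply: Ck_entry.
Qed.

Lemma Ck_mulmx k U m n l (f : V -> 'M[R]_(m, n)) (g : V -> 'M[R]_(n, l)) :
  open U -> Ck k U f -> Ck k U g -> Ck k U (fun x => f x *m g x).
Proof.
move=> oU fk gk; apply: Ck_mx => // i j.
under eq_fun do rewrite mxE.
by apply: Ck_sum => // a; apply: CkM => //; exact: Ck_entry.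
Qed.

Lemma Ck_det k U n (f : V -> 'M[R]_n) : open U ->
  Ck k U f -> Ck k U (fun x => \det (f x)).
Proof.
move=> oU fk; rewrite /determinant.
apply: Ck_sum => // s; apply: CkM => //; first exact: Ck_cst.
by apply: Ck_prod => // i; exact: Ck_entry.
Qed.

(** By Cramer's rule. *)
Lemma Ck_invmx k U n (f : V -> 'M[R]_n) : open U ->
  (forall x, U x -> f x \in unitmx) ->
  Ck k U f -> Ck k U (fun x => invmx (f x)).
Proof.
move=> oU fu fk.
apply: (@Ck_congr _ _ _ _ _ (fun x => (\det (f x))^-1 *: \adj (f x))) => //.
  by move=> x Ux; rewrite /invmx fu.
apply: CkZ => //.
  apply: Ck_inv => //; last exact: Ck_det.
  by move=> x /fu; rewrite unitmxE unitfE.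
apply: Ck_mx => // i j; under eq_fun do rewrite mxE /cofactor.
apply: CkM => //; first exact: Ck_cst.
apply: Ck_det => //; apply: Ck_mx => // a b.
by under eq_fun do rewrite !mxE; exact: Ck_entry.
Qed.

(** The directions [v] in the definition of [Ck] are fixed, while the chain rule
    produces the moving direction ['d f x v]; expanding it in the basis of 'rV_n
    leaves products of functions to which the induction hypothesis applies. *)
Lemma Ck_comp_scalar k U n U' (f : V -> 'rV[R]_n) (g : 'rV[R]_n -> R) :
  open U -> (forall x, U x -> U' (f x)) ->
  Ck k U f -> Ck k U' g -> Ck k U (fun x => g (f x)).
Proof.
move=> oU UU'; elim: k g => [|k IH] g.
  move=> fc gc x Ux; apply: (continuous_comp (fc _ Ux)); exact: gc (UU' _ Ux).
move=> fS gS; have [fd fk] := fS; have [gd gk] := gS; split=> [x Ux|v].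
  by apply: differentiable_comp; [exact: fd|exact: gd (UU' _ Ux)].
apply: (@Ck_congr _ _ _ _ _
    (fun x => \sum_j ('d f x v) 0 j *: 'd g (f x) (delta_mx 0 j))) => //.
  move=> x Ux; apply/esym.
  apply: etrans (congr1 (@^~ v) (diff_comp (fd _ Ux) (gd _ (UU' _ Ux)))) _.
  rewrite [in LHS]/= [in LHS](row_sum_delta ('d f x v)) linear_sum.
  by apply: eq_bigr => j _; rewrite linearZ.
apply: Ck_sum => // j; apply: CkM => //; first exact: Ck_entry (fk v).
by apply: IH (gk _); exact: CkS fS.
Qed.

End CkAlgebra.

Lemma Ck_comp (R : realType) (V : normedModType R) k U n a b U'
    (f : V -> 'rV[R]_n) (g : 'rV[R]_n -> 'M[R]_(a, b)) :
  open U -> open U' -> (forall x, U x -> U' (f x)) ->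
  Ck k U f -> Ck k U' g -> Ck k U (fun x => g (f x)).
Proof.
move=> oU oU' UU' fk gk; apply: Ck_mx => // i j.
exact: (@Ck_comp_scalar _ _ _ _ _ _ _ (fun y => g y i j) oU UU' fk
  (Ck_entry i j oU' gk)).
Qed.

(** * Symmetry of second derivatives *)

Section Schwarz.
Variables (R : realType) (V : normedModType R).
Implicit Types (phi : V -> R) (x v w z : V).

(** Both sides are limits of the same difference quotient. *)
Lemma is_derive_line phi z w (t : R) : differentiable phi (t *: w + z) ->
  is_derive t 1 (fun s : R => phi (s *: w + z)) ('d phi (t *: w + z) w).
Proof.
move=> dphi.
have qE : (fun h : R => h^-1 *: (phi ((h *: 1 + t) *: w + z) - phi (t *: w + z))) =
    (fun h : R => h^-1 *: (phi (h *: w + (t *: w + z)) - phi (t *: w + z))).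
  apply/funext => h; have -> : h *: (1 : R) = h by exact: mulr1.
  by rewrite scalerDl addrA.
apply: DeriveDef; rewrite -?(deriveE w dphi) /derivable /derive /= qE //.
exact: (diff_derivable dphi).
Qed.

Lemma mean_value (u du : R -> R) (s : R) : 0 < s ->
  (forall t : R, 0 <= t <= s -> is_derive t 1 u (du t)) ->
  exists2 t : R, 0 <= t <= s & u s - u 0 = s * du t.
Proof.
move=> s0 dl; have [||t] := @MVT R u du 0 s s0.
- by move=> t; rewrite in_itv/= => /andP[/ltW ? /ltW ?]; apply: dl; apply/andP.
- apply: derivable_within_continuous => t; rewrite in_itv/= => /dl dt.
  exact: (@ex_derive _ _ _ _ _ _ _ dt).
rewrite in_itv/= subr0 => /andP[t0 ts] E.
by exists t; rewrite ?ltW // E mulrC.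
Qed.

(** The second difference of [phi] over a parallelogram is symmetric in [v] and
    [w]; two applications of the mean value theorem express it by the second
    derivative, taken in one order, at some point of the parallelogram. *)
Lemma second_difference phi x v w (s : R) : 0 < s ->
  (forall a b : R, 0 <= a <= s -> 0 <= b <= s ->
    differentiable phi (a *: v + (b *: w + x)) /\
    differentiable (fun z => 'd phi z v) (a *: v + (b *: w + x))) ->
  exists a b : R, [/\ 0 <= a <= s, 0 <= b <= s &
    phi (s *: v + (s *: w + x)) - phi (s *: v + x) - phi (s *: w + x) + phi x =
    s * (s * 'd (fun z => 'd phi z v) (a *: v + (b *: w + x)) w)].
Proof.
move=> s0 H.
have s_in : 0 <= s <= s by rewrite ?lexx (ltW s0) ?lexx.
have o_in : (0 : R) <= 0 <= s by rewrite lexx ltW.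
(* The difference of phi across the side s w, as a function of the step along v. *)
have [t ht|a ha E1] := @mean_value
    (fun t => phi (t *: v + (s *: w + x)) - phi (t *: v + x))
    (fun t => 'd phi (t *: v + (s *: w + x)) v - 'd phi (t *: v + x) v) s s0.
  apply: is_deriveB; apply: is_derive_line; first exact: (H t s ht s_in).1.
  by have [+ _] := H t 0 ht o_in; rewrite scale0r add0r.
have [b hb|b hb E2] := @mean_value
    (fun b => 'd phi (b *: w + (a *: v + x)) v)
    (fun b => 'd (fun z => 'd phi z v) (b *: w + (a *: v + x)) w) s s0.
  apply: (@is_derive_line (fun z => 'd phi z v)).
  by rewrite addrCA; exact: (H a b ha hb).2.
exists a, b; split=> //; move: E1 E2; rewrite !scale0r !add0r.
rewrite [s *: w + (a *: v + x)]addrCA => E1 E2.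
rewrite [a *: v + (b *: w + x)]addrCA -E2 -E1; ring.
Qed.

Lemma schwarz_scalar phi x v w U : open_nbhs x U -> Ck 2 U phi ->
  'd (fun z => 'd phi z v) x w = 'd (fun z => 'd phi z w) x v.
Proof.
move=> [oU Ux] [phid phik].
set A := LHS; set B := RHS.
have cvw : {for x, continuous (fun z => 'd (fun z => 'd phi z v) z w)}.
  exact: ((phik v).2 w x Ux).
have cwv : {for x, continuous (fun z => 'd (fun z => 'd phi z w) z v)}.
  exact: ((phik w).2 v x Ux).
apply/eqP; rewrite -subr_eq0 -normr_le0; apply/ler_addgt0Pr => e e0.
have e20 : 0 < e / 2 by rewrite divr_gt0.
have nA : \forall z \near x, `|A - 'd (fun z => 'd phi z v) z w| < e / 2.
  exact: ((@cvgrPdist_lt _ _ _ _ _ _ _).1 cvw _ e20).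
have nB : \forall z \near x, `|B - 'd (fun z => 'd phi z w) z v| < e / 2.
  exact: ((@cvgrPdist_lt _ _ _ _ _ _ _).1 cwv _ e20).
have nU := open_nbhs_nbhs (conj oU Ux).
have [d /= d0 dN] := (nbhs_ballP _ _).1 (filterI nU (filterI nA nB)).
(* Chosen so that the parallelogram with sides s v and s w at x stays in the ball
   of radius d. *)
pose s := d / 2 / (`|v| + `|w| + 1).
have c0 : 0 < `|v| + `|w| + 1 by rewrite ltr_wpDl// addr_ge0.
have s0 : 0 < s by rewrite !divr_gt0.
have sE : s * (`|v| + `|w| + 1) = d / 2 by rewrite /s divfK ?gt_eqF.
have inball (a b : R) v' w' : 0 <= a <= s -> 0 <= b <= s ->
    `|v'| + `|w'| = `|v| + `|w| -> ball x d (a *: v' + (b *: w' + x)).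
  move=> /andP[a0 asl] /andP[b0 bs] vw; rewrite -ball_normE /ball_/=.
  rewrite distrC addrA addrK (le_lt_trans (ler_normD _ _))// !normrZ.
  rewrite !ger0_norm//.
  have h1 : a * `|v'| <= s * `|v'| by rewrite ler_wpM2r.
  have h2 : b * `|w'| <= s * `|w'| by rewrite ler_wpM2r.
  have : s * `|v'| + s * `|w'| + s = d / 2 by rewrite -sE -vw; ring.
  by move: s0 d0 h1 h2; lra.
have H v' w' : `|v'| + `|w'| = `|v| + `|w| ->
  forall a b : R, 0 <= a <= s -> 0 <= b <= s ->
    differentiable phi (a *: v' + (b *: w' + x)) /\
    differentiable (fun z => 'd phi z v') (a *: v' + (b *: w' + x)).
  move=> vw a b ha hb; have [Uz _] := dN _ (inball a b v' w' ha hb vw).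
  by split; [exact: phid|exact: ((phik v').1 _ Uz)].
have [a [b [ha hb E1]]] := second_difference s0 (H v w erefl).
have [a' [b' [ha' hb' E2]]] := second_difference s0 (H w v (addrC _ _)).
have [_ [/= N1 _]] := dN _ (inball a b v w ha hb erefl).
have [_ [/= _ N2]] := dN _ (inball a' b' w v ha' hb' (addrC _ _)).
have EE : 'd (fun z => 'd phi z v) (a *: v + (b *: w + x)) w =
          'd (fun z => 'd phi z w) (a' *: w + (b' *: v + x)) v.
  apply: (mulfI (lt0r_neq0 s0)); apply: (mulfI (lt0r_neq0 s0)).
  by rewrite -E1 -E2 [s *: w + (s *: v + x)]addrCA; ring.
rewrite add0r; move: N1 N2; rewrite EE -/A -/B.
set C := 'd _ _ v => N1 N2.
rewrite (_ : A - B = (A - C) - (B - C)); last by ring.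
by rewrite (le_trans (ler_normB _ _))//; move: N1 N2; lra.
Qed.

End Schwarz.

(** * Maps smooth near a point *)

Lemma near_open (T : topologicalType) (x : T) (P : set T) : nbhs x P ->
  exists2 B, open_nbhs x B & B `<=` P.
Proof. by rewrite nbhsE. Qed.

Section SmoothAt.
Variables (R : realType) (V : normedModType R).
Implicit Types (W : normedModType R) (x : V).

Lemma near_diff W (f g : V -> W) x v : (\forall y \near x, f y = g y) ->
  differentiable f x -> 'd g x v = 'd f x v.
Proof. move=> fg df; exact: (congr1 (@^~ v) (near_eq_diff fg df).2). Qed.

Lemma smooth_at_congr W (f g : V -> W) x : (\forall y \near x, f y = g y) ->
  smooth_at x f -> smooth_at x g.
Proof.
move=> fg [U [oU Ux] fU].
have [B [oB Bx] Bfg] := near_open fg.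
exists (U `&` B); first by split; [exact: openI|split].
move=> k; apply: (@Ck_congr _ _ _ _ _ f); first exact: openI.
  by move=> y [_ /Bfg].
by apply: Ck_sub (fU k) => y [].
Qed.

Lemma smooth_at_near W (f : V -> W) x : smooth_at x f ->
  \forall y \near x, smooth_at y f.
Proof.
move=> [U [oU Ux] fU]; apply: filterS (open_nbhs_nbhs (conj oU Ux)) => y Uy.
by exists U.
Qed.

Lemma smooth_at_differentiable W (f : V -> W) x : smooth_at x f -> differentiable f x.
Proof. by move=> [U [oU Ux] /(_ 1%N) [fd _]]; exact: fd. Qed.

Lemma smooth_at_diff W (f : V -> W) x v : smooth_at x f ->
  smooth_at x (fun y => 'd f y v).
Proof. by move=> [U oU fU]; exists U => // k; exact: ((fU k.+1).2 v). Qed.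

Lemma smooth_at_cst W (c : W) x : smooth_at x (fun=> c).
Proof. by exists setT => [|k]; [exact: open_nbhsT|exact: Ck_cst]. Qed.

(** The neighbourhoods on which two maps are smooth have to be intersected; done
    once here for all binary operations. *)
Lemma smooth_at2 W W' W'' (f : V -> W) (g : V -> W') (h : V -> W'') x :
  (forall k U, open U -> Ck k U f -> Ck k U g -> Ck k U h) ->
  smooth_at x f -> smooth_at x g -> smooth_at x h.
Proof.
move=> H [U [oU Ux] fU] [U' [oU' Ux'] gU].
exists (U `&` U'); first by split; [exact: openI|split].
move=> k; apply: H; first exact: openI.
  by apply: Ck_sub (fU k) => y [].
by apply: Ck_sub (gU k) => y [].
Qed.

Lemma smooth_at1 W W' (f : V -> W) (h : V -> W') x :
  (forall k U, open U -> Ck k U f -> Ck k U h) -> smooth_at x f -> smooth_at x h.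
Proof. by move=> H [U [oU Ux] fU]; exists U => // k; exact: H. Qed.

Lemma smooth_atD W (f g : V -> W) x : smooth_at x f -> smooth_at x g ->
  smooth_at x (fun y => f y + g y).
Proof. by apply: smooth_at2 => k U; exact: CkD. Qed.

Lemma smooth_at_sum W (I : Type) (r : seq I) (f : I -> V -> W) x :
  (forall i, smooth_at x (f i)) -> smooth_at x (fun y => \sum_(i <- r) f i y).
Proof.
move=> fx; elim: r => [|i r IH].
  by under eq_fun do rewrite big_nil; exact: smooth_at_cst.
by under eq_fun do rewrite big_cons; exact: smooth_atD.
Qed.

Lemma smooth_atM (f g : V -> R) x : smooth_at x f -> smooth_at x g ->
  smooth_at x (fun y => f y * g y).
Proof. by apply: smooth_at2 => k U; exact: CkM. Qed.

Lemma smooth_at_entry m n (f : V -> 'M[R]_(m, n)) x i j :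
  smooth_at x f -> smooth_at x (fun y => f y i j).
Proof. by apply: smooth_at1 => k U; exact: Ck_entry. Qed.

Lemma smooth_atZ m n (u : V -> R) (f : V -> 'M[R]_(m, n)) x :
  smooth_at x u -> smooth_at x f -> smooth_at x (fun y => u y *: f y).
Proof. by apply: smooth_at2 => k U; exact: CkZ. Qed.

Lemma smooth_at_mx m n (f : V -> 'M[R]_(m, n)) x :
  (forall i j, smooth_at x (fun y => f y i j)) -> smooth_at x f.
Proof.
move=> fx; rewrite (_ : f = fun y => \sum_i \sum_j (f y i j *: delta_mx i j)).
  apply: smooth_at_sum => i; apply: smooth_at_sum => j.
  by apply: smooth_atZ; [exact: fx|exact: smooth_at_cst].
by apply/funext => y; exact: matrix_sum_delta.
Qed.

Lemma smooth_atN m n (f : V -> 'M[R]_(m, n)) x :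
  smooth_at x f -> smooth_at x (fun y => - f y).
Proof.
move=> fx; under eq_fun do rewrite -scaleN1r.
by apply: smooth_atZ => //; exact: smooth_at_cst.
Qed.

Lemma smooth_atB m n (f g : V -> 'M[R]_(m, n)) x :
  smooth_at x f -> smooth_at x g -> smooth_at x (fun y => f y - g y).
Proof. by move=> fx gx; apply: smooth_atD => //; exact: smooth_atN. Qed.

Lemma smooth_at_mulmx m n l (f : V -> 'M[R]_(m, n)) (g : V -> 'M[R]_(n, l)) x :
  smooth_at x f -> smooth_at x g -> smooth_at x (fun y => f y *m g y).
Proof. by apply: smooth_at2 => k U; exact: Ck_mulmx. Qed.

Lemma smooth_at_trmx m n (f : V -> 'M[R]_(m, n)) x :
  smooth_at x f -> smooth_at x (fun y => (f y)^T).
Proof.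
move=> fx; apply: smooth_at_mx => i j.
by under eq_fun do rewrite mxE; exact: smooth_at_entry.
Qed.

Lemma smooth_at_invmx n (f : V -> 'M[R]_n) x :
  (\forall y \near x, f y \in unitmx) ->
  smooth_at x f -> smooth_at x (fun y => invmx (f y)).
Proof.
move=> fu [U [oU Ux] fU]; have [B [oB Bx] Bf] := near_open fu.
exists (U `&` B); first by split; [exact: openI|split].
move=> k; apply: Ck_invmx; first exact: openI.
  by move=> y [_ /Bf].
by apply: Ck_sub (fU k) => y [].
Qed.

Lemma smooth_at_comp n a b (f : V -> 'rV[R]_n) (g : 'rV[R]_n -> 'M[R]_(a, b)) x :
  smooth_at x f -> smooth_at (f x) g -> smooth_at x (fun y => g (f y)).
Proof.
move=> fx [U' [oU' Ufx] gU'].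
have nU' : \forall y \near x, U' (f y).
  have := differentiable_continuous (smooth_at_differentiable fx).
  by move=> /(_ U' (open_nbhs_nbhs (conj oU' Ufx))).
have [U [oU Ux] fU] := fx; have [B [oB Bx] Bf] := near_open nU'.
exists (U `&` B); first by split; [exact: openI|split].
move=> k; apply: (Ck_comp (U' := U')) => //; first exact: openI.
  by move=> y [_ /Bf].
by apply: Ck_sub (fU k) => y [].
Qed.

Lemma diff_entry m n (f : V -> 'M[R]_(m, n)) x v i j : differentiable f x ->
  'd (fun y => f y i j) x v = 'd f x v i j.
Proof.
move=> df.
have L_lin : linear (fun A : 'M[R]_(m, n) => A i j) by move=> a u w; rewrite !mxE.
pose LM := GRing.isLinear.Build _ _ _ _ _ L_lin.
pose L : {linear 'M[R]_(m, n) -> R} := HB.pack (fun A : 'M[R]_(m, n) => A i j) LM.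
have cL : continuous L by exact: (@matrix_normedtype.coord_continuous R m n i j).
apply: etrans (congr1 (@^~ v) (diff_comp df (linear_differentiable (f x) cL))) _.
exact: (congr1 (@^~ ('d f x v)) (diff_lin (f x) cL)).
Qed.

Lemma diff_cst_eq0 W (c : W) x v : 'd (fun=> c) x v = 0.
Proof. exact: (congr1 (@^~ v) (diff_cst c x)). Qed.

Lemma diff_add W (f g : V -> W) x v : differentiable f x -> differentiable g x ->
  'd (fun y => f y + g y) x v = 'd f x v + 'd g x v.
Proof. move=> df dg; exact: (congr1 (@^~ v) (diffD df dg)). Qed.

Lemma diff_big W (I : Type) (r : seq I) (f : I -> V -> W) x v :
  (forall i, smooth_at x (f i)) ->
  'd (fun y => \sum_(i <- r) f i y) x v = \sum_(i <- r) 'd (f i) x v.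
Proof.
move=> fx; elim: r => [|i r IH].
  by under eq_fun do rewrite big_nil; rewrite big_nil; exact: diff_cst_eq0.
under eq_fun do rewrite big_cons; rewrite big_cons -IH.
apply: diff_add; first exact: smooth_at_differentiable.
by apply: smooth_at_differentiable; exact: smooth_at_sum.
Qed.

(** Reduces, entry by entry, to the product rule for real functions. *)
Lemma diff_mulmx m n l (f : V -> 'M[R]_(m, n)) (g : V -> 'M[R]_(n, l)) x v :
  smooth_at x f -> smooth_at x g ->
  'd (fun y => f y *m g y) x v = 'd f x v *m g x + f x *m 'd g x v.
Proof.
move=> fx gx; apply/matrixP => i j.
have dfg := smooth_at_differentiable (smooth_at_mulmx fx gx).
have df := smooth_at_differentiable fx; have dg := smooth_at_differentiable gx.
rewrite -(diff_entry _ i j dfg) !mxE -big_split /=.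
under eq_fun do rewrite mxE.
rewrite diff_big => [|a]; last by apply: smooth_atM; exact: smooth_at_entry.
apply: eq_bigr => a _; rewrite -(diff_entry _ i a df) -(diff_entry _ a j dg).
apply: etrans (congr1 (@^~ v) (diffM (smooth_at_differentiable (smooth_at_entry i a fx))
  (smooth_at_differentiable (smooth_at_entry a j gx)))) _.
rewrite [RHS]addrC [X in _ = _ + X]mulrC; exact: erefl.
Qed.

End SmoothAt.

Section Jacobian.
Variable R : realType.

Lemma mul_jacobian m n (f : 'rV[R]_m -> 'rV[R]_n) x v :
  v *m jacobian f x = 'd f x v.
Proof. exact: mul_rV_lin1. Qed.

Lemma smooth_at_jacobian m n (f : 'rV[R]_m -> 'rV[R]_n) x :
  smooth_at x f -> smooth_at x (jacobian f).
Proof.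
move=> fx; apply: smooth_at_mx => i j.
under eq_fun do rewrite /jacobian mxE.
by apply: smooth_at_entry; exact: smooth_at_diff.
Qed.

(** The scalar case, applied to the entries of [f]. *)
Lemma schwarz m n (f : 'rV[R]_m -> 'rV[R]_n) x v w : smooth_at x f ->
  'd (fun z => 'd f z v) x w = 'd (fun z => 'd f z w) x v.
Proof.
move=> fx; apply/matrixP => i j.
have E u u' : 'd (fun z => 'd f z u) x u' i j =
    'd (fun z => 'd (fun y => f y i j) z u) x u'.
  rewrite -diff_entry; last exact/smooth_at_differentiable/smooth_at_diff.
  apply: near_diff; last first.
    exact/smooth_at_differentiable/smooth_at_diff/smooth_at_entry.
  apply: filterS (smooth_at_near fx) => z fz.
  by rewrite diff_entry //; exact: smooth_at_differentiable.
rewrite !E; have [U oU fU] := smooth_at_entry i j fx.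
exact: (schwarz_scalar v w oU (fU 2%N)).
Qed.

(** The second derivative of [f] contributes the same term to both summands of the
    left-hand side, so it cancels. With [f] the expression of a map in charts this
    is the naturality of the Lie bracket; with [f] a change of charts it is its
    independence of the chart. *)
Lemma commutator_push m n (f : 'rV[R]_m -> 'rV[R]_n) (X Y : 'rV[R]_m -> 'rV[R]_m) x :
  smooth_at x f -> smooth_at x X -> smooth_at x Y ->
  'd (fun z => 'd f z (Y z)) x (X x) - 'd (fun z => 'd f z (X z)) x (Y x) =
  'd f x ('d Y x (X x) - 'd X x (Y x)).
Proof.
move=> fx sX sY.
have sJ := smooth_at_jacobian fx.
(* Differentiate the moving argument Z and the map f separately. *)
have E (Z : 'rV[R]_m -> 'rV[R]_m) u : smooth_at x Z ->
    'd (fun z => 'd f z (Z z)) x u =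
    'd f x ('d Z x u) + 'd (fun z => 'd f z (Z x)) x u.
  move=> sZ; under eq_fun do rewrite -mul_jacobian.
  apply: etrans (diff_mulmx u sZ sJ) _; rewrite mul_jacobian; congr (_ + _).
  apply/esym; under eq_fun do rewrite -mul_jacobian.
  apply: etrans (diff_mulmx u (smooth_at_cst (Z x) x) sJ) _.
  by rewrite diff_cst_eq0 mul0mx add0r.
have cancel (a b c d : 'rV[R]_n) : c = d -> (a + c) - (b + d) = a - b.
  by move=> ->; rewrite opprD addrACA subrr addr0.
apply: etrans (congr2 (fun a b => a - b) (E Y (X x) sY) (E X (Y x) sX)) _.
apply: etrans (cancel _ _ _ _ (schwarz (Y x) (X x) fx)) _.
exact/esym/linearB.
Qed.

End Jacobian.

(** * Charts and local expressions of maps *)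

Section Chart.
Variables (R : realType) (T : topologicalType) (n : nat) (c : chart R T n).

Lemma near_cdom q : cdom c q -> \forall r \near q, cdom c r.
Proof. by move=> cq; exact: open_nbhs_nbhs (conj (@cdom_open _ _ _ c) cq). Qed.

(** A property that holds near [q] can be read off in the coordinates of a chart. *)
Lemma near_cinv q (P : set T) : cdom c q -> (\forall r \near q, P r) ->
  \forall z \near coord c q, [/\ cdom c (cinv c z), coord c (cinv c z) = z &
    P (cinv c z)].
Proof.
move=> cq nP.
have im : (coord c @` cdom c) (coord c q) by exists q.
have n1 := open_nbhs_nbhs (conj (@cimg_open _ _ _ c) im).
have n2 : \forall z \near coord c q, P (cinv c z).
  by apply: (cinv_continuous im); rewrite coordK.
by apply: filterS2 n1 n2 => z [r cr <-]; rewrite coordK.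
Qed.

End Chart.

Section Maps.
Variables (R : realType).

Definition locrep m n (S : manifold R m) (M : manifold R n) (h : S -> M) x y :
    'rV[R]_m -> 'rV[R]_n :=
  coord (chart_at y) \o h \o cinv (chart_at x).

(** Covers both [tchange] (for [h] the identity) and [dmap] (for [y = h x]), so that
    one chain rule serves for all of them. *)
Definition Jac m n (S : manifold R m) (M : manifold R n) (h : S -> M) x y q :
    'M[R]_(m, n) :=
  jacobian (locrep h x y) (coord (chart_at x) q).

Definition in_chart n (M : manifold R n) (x q : M) := cdom (chart_at x) q.

Lemma in_chart_refl n (M : manifold R n) (x : M) : in_chart x x.
Proof. exact: chart_at_cdom. Qed.

Lemma near_in_chart n (M : manifold R n) (x q : M) : in_chart x q ->
  \forall r \near q, in_chart x r.
Proof. exact: near_cdom. Qed.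

Lemma smooth_transition n (M : manifold R n) (x y q : M) :
  in_chart x q -> in_chart y q -> smooth_at (coord (chart_at x) q) (locrep idfun x y).
Proof.
move=> xq yq; have sm := atlas_smooth (chart_at_atlas x) (chart_at_atlas y).
have nU : nbhs (coord (chart_at x) q)
    (coord (chart_at x) @` (in_chart x `&` in_chart y)).
  apply: filterS (near_cinv xq (near_in_chart yq)) => z [xz cz yz].
  by exists (cinv (chart_at x) z).
have [B oB Bs] := near_open nU.
exists B => // k; apply: Ck_sub (sm k) => z /Bs; exact.
Qed.

Lemma smooth_map_id n (M : manifold R n) : smooth_map (@idfun M).
Proof.
split=> [|p]; first by move=> p.
by apply: smooth_transition; exact: in_chart_refl.
Qed.

Section SmoothMap.
Variables (m n : nat) (S : manifold R m) (M : manifold R n) (h : S -> M).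
Hypothesis sh : smooth_map h.

Lemma near_map q (P : set M) : (\forall r \near h q, P r) -> \forall r \near q, P (h r).
Proof. by have [ch _] := sh; exact: ch. Qed.

(** [smooth_map] speaks of the charts chosen at [q] and [h q] only; composing with
    transition maps on both sides reaches every pair of charts. *)
Lemma smooth_locrep x y q : in_chart x q -> in_chart y (h q) ->
  smooth_at (coord (chart_at x) q) (locrep h x y).
Proof.
move=> xq yq.
pose g z := locrep idfun (h q) y (locrep h q (h q) (locrep idfun x q z)).
have E : locrep idfun x q (coord (chart_at x) q) = coord (chart_at q) q.
  by rewrite /locrep /= coordK.
apply: (@smooth_at_congr _ _ _ g).
  have n1 := near_cinv xq (near_in_chart (in_chart_refl q)).
  have n2 := near_cinv xq (near_map (near_in_chart (in_chart_refl (h q)))).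
  apply: filterS2 n1 n2 => z [_ _ iz] [_ _ hz].
  by rewrite /g /locrep /= (coordK iz) (coordK hz).
apply: smooth_at_comp; last first.
  rewrite E /locrep /= coordK; last exact: in_chart_refl.
  by apply: smooth_transition yq; exact: in_chart_refl.
apply: smooth_at_comp; last by rewrite E; exact: sh.2.
by apply: smooth_transition => //; exact: in_chart_refl.
Qed.

End SmoothMap.

Lemma Jac_comp m n l (S : manifold R m) (M : manifold R n) (N : manifold R l)
    (h : S -> M) (k : M -> N) x y z q : smooth_map h -> smooth_map k ->
  in_chart x q -> in_chart y (h q) -> in_chart z (k (h q)) ->
  Jac h x y q *m Jac k y z (h q) = Jac (k \o h) x z q.
Proof.
move=> sh sk xq yq zq; apply/row_matrixP => i; rewrite !rowE mulmxA.
rewrite !mul_jacobian.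
have s1 := smooth_locrep sh xq yq.
have s2 := smooth_locrep sk yq zq.
have E : locrep h x y (coord (chart_at x) q) = coord (chart_at y) (h q).
  by rewrite /locrep /= coordK.
rewrite -E in s2 *.
have d1 := smooth_at_differentiable s1; have d2 := smooth_at_differentiable s2.
apply/esym; apply: etrans (congr1 (@^~ (delta_mx 0 i)) (diff_comp d1 d2)).
apply: near_diff; last exact: differentiable_comp d1 d2.
apply: filterS (near_cinv xq (near_map sh (near_in_chart yq))) => u [_ _ hu].
by rewrite /locrep /= (coordK hu).
Qed.

Lemma Jac_id n (M : manifold R n) (x q : M) : in_chart x q -> Jac idfun x x q = 1%:M.
Proof.
move=> xq; apply/row_matrixP => i; rewrite !rowE mul_jacobian mulmx1.
apply: etrans (congr1 (@^~ (delta_mx 0 i))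
  (@diff_val _ _ _ _ _ _ _ (is_diff_id (coord (chart_at x) q)))).
apply: near_diff; last exact: ex_diff.
by apply: filterS (near_cinv xq (near_in_chart xq)) => u [_ E _]; rewrite /locrep /= E.
Qed.

Lemma tchangeE n (M : manifold R n) (x y q : M) : tchange x y q = Jac idfun x y q.
Proof. exact: erefl. Qed.

Lemma dmapE m n (S : manifold R m) (M : manifold R n) (h : S -> M) p :
  dmap h p = Jac h p (h p) p.
Proof. exact: erefl. Qed.

Lemma tchangeM n (M : manifold R n) (x y z q : M) :
  in_chart x q -> in_chart y q -> in_chart z q ->
  tchange x y q *m tchange y z q = tchange x z q.
Proof.
move=> xq yq zq.
by rewrite !tchangeE (Jac_comp (smooth_map_id _) (smooth_map_id _)).
Qed.

Lemma tchange_id n (M : manifold R n) (x q : M) : in_chart x q -> tchange x x q = 1%:M.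
Proof. exact: Jac_id. Qed.

Lemma tchangeK n (M : manifold R n) (x y q : M) : in_chart x q -> in_chart y q ->
  tchange x y q *m tchange y x q = 1%:M.
Proof. by move=> xq yq; rewrite tchangeM // tchange_id. Qed.

Lemma Jac_tchange m n (S : manifold R m) (M : manifold R n) (h : S -> M) x x' y y' q :
  smooth_map h -> in_chart x q -> in_chart x' q -> in_chart y (h q) ->
  in_chart y' (h q) ->
  tchange x x' q *m Jac h x' y' q *m tchange y' y (h q) = Jac h x y q.
Proof.
move=> sh xq xq' yq yq'.
rewrite !tchangeE (Jac_comp (smooth_map_id _) sh) //.
by rewrite (@Jac_comp _ _ _ _ _ _ (h \o idfun) idfun _ _ _ _ sh (smooth_map_id _)).
Qed.

End Maps.

(** * Smooth functions on a manifold *)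

Section SmoothFun.
Variables (R : realType) (m : nat) (S : manifold R m).
Implicit Types p q : S.

Lemma smooth_fun_congr (W : normedModType R) (u v : S -> W) p :
  (\forall q \near p, u q = v q) -> smooth_fun_at p u -> smooth_fun_at p v.
Proof.
move=> uv; apply: smooth_at_congr.
by apply: filterS (near_cinv (chart_at_cdom p) uv) => z [].
Qed.

Lemma smooth_fun_cst (W : normedModType R) (c : W) p : smooth_fun_at p (fun=> c).
Proof. exact: smooth_at_cst. Qed.

Lemma smooth_funD (W : normedModType R) (u v : S -> W) p :
  smooth_fun_at p u -> smooth_fun_at p v -> smooth_fun_at p (fun q => u q + v q).
Proof. exact: smooth_atD. Qed.

Lemma smooth_fun_mulmx a b c (u : S -> 'M[R]_(a, b)) (v : S -> 'M[R]_(b, c)) p :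
  smooth_fun_at p u -> smooth_fun_at p v -> smooth_fun_at p (fun q => u q *m v q).
Proof. exact: smooth_at_mulmx. Qed.

Lemma smooth_funB a b (u v : S -> 'M[R]_(a, b)) p :
  smooth_fun_at p u -> smooth_fun_at p v -> smooth_fun_at p (fun q => u q - v q).
Proof. exact: smooth_atB. Qed.

Lemma smooth_funZ a b (c : S -> R^o) (u : S -> 'M[R]_(a, b)) p :
  smooth_fun_at p c -> smooth_fun_at p u -> smooth_fun_at p (fun q => c q *: u q).
Proof. exact: smooth_atZ. Qed.

Lemma smooth_fun_trmx a b (u : S -> 'M[R]_(a, b)) p :
  smooth_fun_at p u -> smooth_fun_at p (fun q => (u q)^T).
Proof. exact: smooth_at_trmx. Qed.

Lemma smooth_fun_entry a b (u : S -> 'M[R]_(a, b)) p i j :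
  smooth_fun_at p u -> smooth_fun_at p (fun q => u q i j : R^o).
Proof. exact: smooth_at_entry. Qed.

Lemma smooth_fun_mx a b (u : S -> 'M[R]_(a, b)) p :
  (forall i j, smooth_fun_at p (fun q => u q i j : R^o)) -> smooth_fun_at p u.
Proof. exact: smooth_at_mx. Qed.

Lemma smooth_fun_rows a b (u : S -> 'M[R]_(a, b)) p :
  (forall i, smooth_fun_at p (fun q => row i (u q))) -> smooth_fun_at p u.
Proof.
move=> su; apply: smooth_fun_mx => i j.
rewrite (_ : (fun q => _) = fun q => row i (u q) 0 j); last first.
  by apply/funext => q; rewrite mxE.
exact: smooth_fun_entry (su i).
Qed.

Lemma smooth_fun_invmx a (u : S -> 'M[R]_a) p :
  (\forall q \near p, u q \in unitmx) ->
  smooth_fun_at p u -> smooth_fun_at p (fun q => invmx (u q)).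
Proof.
move=> uu; apply: smooth_at_invmx.
by apply: filterS (near_cinv (chart_at_cdom p) uu) => z [].
Qed.

Lemma deriv_congr (W : normedModType R) (u v : S -> W) p w :
  (\forall q \near p, u q = v q) -> smooth_fun_at p u -> deriv v p w = deriv u p w.
Proof.
move=> uv su; apply: near_diff; last exact: smooth_at_differentiable.
by apply: filterS (near_cinv (chart_at_cdom p) uv) => z [].
Qed.

Lemma deriv_cst (W : normedModType R) (c : W) p w : deriv (fun=> c) p w = 0.
Proof. exact: diff_cst_eq0. Qed.

Lemma derivD (W : normedModType R) (u v : S -> W) p w :
  smooth_fun_at p u -> smooth_fun_at p v ->
  deriv (fun q => u q + v q) p w = deriv u p w + deriv v p w.
Proof. by move=> su sv; apply: diff_add; exact: smooth_at_differentiable. Qed.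

Lemma deriv_mulmx a b c (u : S -> 'M[R]_(a, b)) (v : S -> 'M[R]_(b, c)) p w :
  smooth_fun_at p u -> smooth_fun_at p v ->
  deriv (fun q => u q *m v q) p w = deriv u p w *m v p + u p *m deriv v p w.
Proof.
move=> su sv; apply: etrans (diff_mulmx w su sv) _.
by rewrite /= /coord_at (coordK (chart_at_cdom p)).
Qed.

Lemma deriv_entry a b (u : S -> 'M[R]_(a, b)) p w i j : smooth_fun_at p u ->
  deriv (fun q => u q i j : R^o) p w = deriv u p w i j.
Proof. by move=> su; apply: diff_entry; exact: smooth_at_differentiable. Qed.

(** [deriv] at [q] is computed in the chart of [q]; this moves it to the chart of a
    fixed [x], where it can be studied as a function of [q]. *)
Lemma deriv_chart (W : normedModType R) (u : S -> W) x q w : in_chart x q ->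
  smooth_at (coord (chart_at x) q) (u \o cinv (chart_at x)) ->
  deriv u q w = 'd (u \o cinv (chart_at x)) (coord (chart_at x) q) (w *m tchange q x q).
Proof.
move=> xq su.
have st := smooth_locrep (smooth_map_id S) (in_chart_refl q) xq.
have E : locrep idfun q x (coord (chart_at q) q) = coord (chart_at x) q.
  by rewrite /locrep /= coordK //; exact: in_chart_refl.
rewrite -E in su *.
have d1 := smooth_at_differentiable st; have d2 := smooth_at_differentiable su.
rewrite tchangeE mul_jacobian.
apply: etrans (congr1 (@^~ w) (diff_comp d1 d2)).
apply: near_diff; last exact: differentiable_comp d1 d2.
apply: filterS (near_cinv (in_chart_refl q) (near_in_chart xq)) => z [_ _ xz].
by rewrite /locrep /= (coordK xz).
Qed.

End SmoothFun.

(** * Pullback along a smooth map and the Lie bracket *)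

Section Pullback.
Variables (R : realType) (m n : nat) (S : manifold R m) (M : manifold R n).
Variables (f : S -> M).
Hypothesis sf : smooth_map f.

Lemma locrepE p :
  locrep f p (f p) (coord (chart_at p) p) = coord (chart_at (f p)) (f p).
Proof. by rewrite /locrep /= coordK //; exact: in_chart_refl. Qed.

Lemma near_cinv_map (p : S) : \forall z \near coord_at p,
  cinv (chart_at (f p)) (locrep f p (f p) z) = f (cinv (chart_at p) z).
Proof.
have nf := near_cinv (in_chart_refl p)
  (near_map sf (near_in_chart (in_chart_refl (f p)))).
by apply: filterS nf => z [_ _ fz]; rewrite /locrep /= coordK.
Qed.

Lemma smooth_fun_comp a b (u : M -> 'M[R]_(a, b)) p :
  smooth_fun_at (f p) u -> smooth_fun_at p (fun q => u (f q)).
Proof.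
move=> su; have sl := smooth_locrep sf (in_chart_refl p) (in_chart_refl (f p)).
rewrite /smooth_fun_at /coord_at -locrepE in su.
apply: smooth_at_congr (smooth_at_comp sl su).
by apply: filterS (near_cinv_map p) => z /= ->.
Qed.

Lemma deriv_comp a b (u : M -> 'M[R]_(a, b)) p w : smooth_fun_at (f p) u ->
  deriv (fun q => u (f q)) p w = deriv u (f p) (w *m dmap f p).
Proof.
move=> su; have sl := smooth_locrep sf (in_chart_refl p) (in_chart_refl (f p)).
rewrite dmapE mul_jacobian /deriv.
rewrite /smooth_fun_at /coord_at -locrepE in su *.
have d1 := smooth_at_differentiable sl; have d2 := smooth_at_differentiable su.
apply: etrans (congr1 (@^~ w) (diff_comp d1 d2)).
apply: near_diff; last exact: differentiable_comp d1 d2.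
by apply: filterS (near_cinv_map p) => z /= ->.
Qed.

Lemma smooth_fun_Jac p : smooth_fun_at p (fun q => Jac f p (f p) q).
Proof.
have sl := smooth_locrep sf (in_chart_refl p) (in_chart_refl (f p)).
apply: smooth_at_congr (smooth_at_jacobian sl).
apply: filterS (near_cinv (in_chart_refl p) (near_in_chart (in_chart_refl p))).
by move=> z [_ E _]; rewrite /Jac /= E.
Qed.

Lemma push_Jac (X : S -> 'rV[R]_m) y q : in_chart y (f q) ->
  push f X q *m tchange (f q) y (f q) = X q *m Jac f q y q.
Proof.
move=> yq; rewrite /push dmapE tchangeE -mulmxA; congr (_ *m _).
exact: (Jac_comp sf (smooth_map_id M) (in_chart_refl q) (in_chart_refl (f q)) yq).
Qed.

Lemma Jac_base x y q : in_chart x q -> in_chart y (f q) ->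
  tchange q x q *m Jac f x y q = Jac f q y q.
Proof.
by move=> xq yq; exact: (Jac_comp (smooth_map_id S) sf (in_chart_refl q) xq yq).
Qed.

(** In the charts of [p] and [f p], pushing forward is multiplication by the
    jacobian of one fixed local expression of [f], which is smooth. *)
Lemma smooth_push p (X : S -> 'rV[R]_m) :
  smooth_field_at idfun p X -> smooth_field_at f p (push f X).
Proof.
move=> sX; apply: smooth_fun_congr (smooth_fun_mulmx sX (smooth_fun_Jac p)).
have n1 := near_in_chart (in_chart_refl p).
have n2 := near_map sf (near_in_chart (in_chart_refl (f p))).
apply: filterS2 n1 n2 => q pq fq.
exact: etrans (etrans (esym (mulmxA _ _ _)) (congr1 (mulmx (X q)) (Jac_base pq fq)))
  (esym (push_Jac X fq)).
Qed.

(** Chart independence of the Lie bracket (for [f] the identity) and its naturality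
    under [f] in a single formula, where the right-hand side involves one fixed
    target chart [y]. *)
Lemma bracket_Jac (X Y : S -> 'rV[R]_m) y q : in_chart y (f q) ->
  smooth_field_at idfun q X -> smooth_field_at idfun q Y ->
  bracket X Y q *m Jac f q y q =
  deriv (fun r => Y r *m Jac f r y r) q (X q) -
  deriv (fun r => X r *m Jac f r y r) q (Y q).
Proof.
move=> yq sX sY; have sl := smooth_locrep sf (in_chart_refl q) yq.
have cE (Z : S -> 'rV[R]_m) :
    components idfun q Z (cinv (chart_at q) (coord (chart_at q) q)) = Z q.
  rewrite coordK ?/components; last exact: in_chart_refl.
  by rewrite tchange_id ?mulmx1 //; exact: in_chart_refl.
have dE (Z : S -> 'rV[R]_m) w : smooth_field_at idfun q Z ->
    deriv (fun r => Z r *m Jac f r y r) q w =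
    'd (fun z => 'd (locrep f q y) z (components idfun q Z (cinv (chart_at q) z)))
       (coord (chart_at q) q) w.
  move=> sZ; apply: near_diff.
    have n1 := near_cinv (in_chart_refl q) (near_in_chart (in_chart_refl q)).
    have n2 := near_cinv (in_chart_refl q) (near_map sf (near_in_chart yq)).
    apply: filterS2 n1 n2 => z [_ zE qz] [_ _ yz].
    rewrite -mul_jacobian /components -mulmxA /=.
    by rewrite -(Jac_base qz yz) /Jac zE.
  apply: smooth_at_differentiable.
  under eq_fun do rewrite -mul_jacobian.
  exact: smooth_at_mulmx sZ (smooth_at_jacobian sl).
apply/esym; apply: etrans (congr2 (fun a b => a - b) (dE Y (X q) sY) (dE X (Y q) sX)) _.
have H := commutator_push sl sX sY; rewrite /= /coord_at !cE in H.
exact: etrans H (esym (mul_jacobian _ _ _)).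
Qed.

End Pullback.

Section Bracket.
Variables (R : realType) (m : nat) (S : manifold R m).

Lemma bracket_components (X Y : S -> 'rV[R]_m) x q : in_chart x q ->
  smooth_field_at idfun q X -> smooth_field_at idfun q Y ->
  components idfun x (bracket X Y) q =
  deriv (components idfun x Y) q (X q) - deriv (components idfun x X) q (Y q).
Proof. exact: (@bracket_Jac _ _ _ _ _ idfun (smooth_map_id S)). Qed.

(** The components of the bracket in the chart of [p] are, near [p], those
    computed from the components of [X] and [Y] in that one chart. *)
Lemma smooth_bracket (X Y : S -> 'rV[R]_m) p :
  (forall q, smooth_field_at idfun q X) -> (forall q, smooth_field_at idfun q Y) ->
  smooth_field_at idfun p (bracket X Y).
Proof.
move=> sX sY; pose loc (Z : S -> 'rV[R]_m) := components idfun p Z \o cinv (chart_at p).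
have := smooth_atB (smooth_at_mulmx (sX p) (smooth_at_jacobian (sY p)))
  (smooth_at_mulmx (sY p) (smooth_at_jacobian (sX p))).
apply: smooth_at_congr.
have near_smooth Z : (forall q, smooth_field_at idfun q Z) ->
    \forall z \near coord_at p, smooth_at z (loc Z).
  by move=> sZ; exact: smooth_at_near (sZ p).
have n1 := near_cinv (in_chart_refl p) (near_in_chart (in_chart_refl p)).
apply: filterS3 n1 (near_smooth X sX) (near_smooth Y sY) => z [_ zE pz] lX lY.
rewrite /= (bracket_components pz (sX _) (sY _)).
have dE Z w : smooth_at z (loc Z) ->
    deriv (components idfun p Z) (cinv (chart_at p) z) w =
    (w *m tchange (cinv (chart_at p) z) p (cinv (chart_at p) z)) *m jacobian (loc Z) z.
  move=> lZ; have lZ' := lZ; rewrite -zE in lZ'.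
  have H := deriv_chart w pz lZ'; rewrite zE in H.
  exact: etrans H (esym (mul_jacobian _ _ _)).
by rewrite (dE Y _ lY) (dE X _ lX).
Qed.

Lemma push_bracket n (M : manifold R n) (f : S -> M) (X Y : S -> 'rV[R]_m) p :
  smooth_map f -> smooth_field_at idfun p X -> smooth_field_at idfun p Y ->
  push f (bracket X Y) p =
  deriv (components f p (push f Y)) p (X p) - deriv (components f p (push f X)) p (Y p).
Proof.
move=> sf sX sY.
rewrite /push dmapE (bracket_Jac sf (in_chart_refl (f p)) sX sY).
have E (Z : S -> 'rV[R]_m) w : smooth_field_at idfun p Z ->
    deriv (fun r => Z r *m Jac f r (f p) r) p w = deriv (components f p (push f Z)) p w.
  move=> sZ; apply: deriv_congr; last exact: smooth_push.
  apply: filterS (near_map sf (near_in_chart (in_chart_refl (f p)))) => q fq.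
  exact: push_Jac.
by rewrite (E Y _ sY) (E X _ sX).
Qed.

End Bracket.

(** * Orthogonal projection onto a row space *)

Section InnerProduct.
Variables (R : realType) (m n : nat).
Implicit Types (G : 'M[R]_n) (B : 'M[R]_(m, n)).

Lemma ipDr G u v w : ip G w (u + v) = ip G w u + ip G w v.
Proof. by rewrite /ip linearD mulmxDr mxE. Qed.

Lemma ipNr G u v : ip G u (- v) = - ip G u v.
Proof. by rewrite /ip linearN mulmxN mxE. Qed.

Lemma ip_eq0 G u v : (ip G u v == 0) = (u *m G *m v^T == 0).
Proof. by rewrite [u *m _ *m _]mx11_scalar -scalemx1 scaler_eq0 /ip oner_eq0 orbF. Qed.

Definition posdef G := forall u, u != 0 -> 0 < ip G u u.

Lemma posdef_eq0 G u : posdef G -> ip G u u = 0 -> u = 0.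
Proof. by move=> pG u0; have [//|/pG] := eqVneq u 0; rewrite u0 ltxx. Qed.

Definition gram G B := B *m G *m B^T.

(** A vector [u] is sent to the coordinates, in the rows of [B], of its
    [G]-orthogonal projection to the row space of [B]; this closed formula makes
    the tangential projection of a submanifold smooth. *)
Definition ortho_coord G B : 'M[R]_(n, m) := G *m B^T *m invmx (gram G B).

Lemma gram_unit G B : posdef G -> row_free B -> gram G B \in unitmx.
Proof.
move=> pG fB; rewrite -row_free_unit -kermx_eq0; apply/rowV0P => u /sub_kermxP u0.
have : u *m B = 0.
  apply: (posdef_eq0 pG); apply/eqP; rewrite ip_eq0 trmx_mul.
  by rewrite !mulmxA; move: u0; rewrite /gram !mulmxA => ->; rewrite mul0mx.
by move/eqP; rewrite mulmx_free_eq0 // => /eqP.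
Qed.

Lemma ortho_coordK G B : posdef G -> row_free B -> B *m ortho_coord G B = 1%:M.
Proof. by move=> pG fB; rewrite /ortho_coord !mulmxA mulmxV // gram_unit. Qed.

Lemma ortho_coord_ker l G B (u : 'M[R]_(l, n)) :
  u *m (G *m B^T) = 0 -> u *m ortho_coord G B = 0.
Proof. by rewrite /ortho_coord !mulmxA => ->; rewrite mul0mx. Qed.

Lemma ortho_ker l G B (u : 'M[R]_(l, n)) : posdef G -> row_free B ->
  (u - u *m ortho_coord G B *m B) *m (G *m B^T) = 0.
Proof.
move=> pG fB; have E : B *m (G *m B^T) = gram G B by rewrite mulmxA.
rewrite mulmxBl /ortho_coord -!mulmxA E mulVmx ?gram_unit //.
by rewrite mulmx1 subrr.
Qed.

Lemma ortho_disjoint G B : posdef G -> row_free B ->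
  (<<B>> :&: kermx (G *m B^T) = 0)%MS.
Proof.
move=> pG fB; apply/eqP; rewrite -submx0; apply/rV_subP => u.
rewrite sub_capmx genmxE => /andP[/submxP[a ->] /sub_kermxP].
move/ortho_coord_ker; rewrite -mulmxA ortho_coordK // mulmx1 => ->.
by rewrite mul0mx sub0mx.
Qed.

Lemma proj_tangent G B : posdef G -> row_free B ->
  proj_mx <<B>>%MS (kermx (G *m B^T)) = ortho_coord G B *m B.
Proof.
move=> pG fB; apply/row_matrixP => i; rewrite !rowE.
set u := delta_mx 0 i; rewrite [RHS]mulmxA; set w := u *m _ *m B; set P := proj_mx _ _.
have D0 := ortho_disjoint pG fB.
have h1 : (u - w) *m P = 0.
  by apply: proj_mx_0 D0 _; apply/sub_kermxP; exact: ortho_ker.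
have h2 : w *m P = w by apply: proj_mx_id D0 _; rewrite genmxE submxMl.
by rewrite -[u in LHS](subrK w u) mulmxDl h1 h2 add0r.
Qed.

Lemma proj_normal G B : posdef G -> row_free B ->
  proj_mx (kermx (G *m B^T)) <<B>>%MS = 1%:M - ortho_coord G B *m B.
Proof.
move=> pG fB; apply/row_matrixP => i; rewrite !rowE.
set u := delta_mx 0 i; rewrite [RHS]mulmxBr mulmx1 [u *m (_ *m B)]mulmxA.
set w := u *m _ *m B; set P := proj_mx _ _.
have D0 : (kermx (G *m B^T) :&: <<B>> = 0)%MS by rewrite capmxC ortho_disjoint.
have h1 : (u - w) *m P = u - w.
  by apply: proj_mx_id D0 _; apply/sub_kermxP; exact: ortho_ker.
have h2 : w *m P = 0 by apply: proj_mx_0 D0 _; rewrite genmxE submxMl.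
by rewrite -[u in LHS](subrK w u) mulmxDl h1 h2 addr0.
Qed.

End InnerProduct.

Section ChangeOfBasis.
Variables (R : realType) (m n : nat) (G : 'M[R]_n) (B : 'M[R]_(m, n)).
Variables (A A' : 'M[R]_n) (C C' : 'M[R]_m).
Hypotheses (A'A : A' *m A = 1%:M) (CC' : C *m C' = 1%:M).

Lemma gram_base : gram (A *m G *m A^T) (C *m B *m A') = C *m gram G B *m C^T.
Proof.
rewrite /gram !trmx_mul !mulmxA -[C *m B *m A' *m A]mulmxA A'A mulmx1.
by rewrite -[_ *m A^T *m A'^T]mulmxA -trmx_mul A'A trmx1 mulmx1.
Qed.

Lemma gram_base_unit : gram G B \in unitmx ->
  gram (A *m G *m A^T) (C *m B *m A') \in unitmx.
Proof.
have [uC _] := mulmx1_unit CC'.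
by rewrite gram_base !unitmx_mul unitmx_tr uC => ->.
Qed.

(** How the projection transforms when the components of the ambient vectors
    change by [A] and those of the vectors of the subspace by [C]. *)
Lemma ortho_coord_base : gram G B \in unitmx ->
  ortho_coord (A *m G *m A^T) (C *m B *m A') = A *m ortho_coord G B *m C'.
Proof.
have C'C := mulmx1C CC'; have [uC _] := mulmx1_unit CC'.
rewrite /ortho_coord gram_base; move: (gram G B) => H uH; rewrite !trmx_mul !mulmxA.
rewrite -[_ *m A^T *m A'^T]mulmxA -trmx_mul A'A trmx1 mulmx1.
have -> : invmx (C *m H *m C^T) = C'^T *m invmx H *m C'.
  apply: (can_inj (mulKmx (_ : C *m H *m C^T \in unitmx))).
    by rewrite !unitmx_mul unitmx_tr uC uH.
  rewrite mulmxV; last by rewrite !unitmx_mul unitmx_tr uC uH.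
  rewrite !mulmxA -[_ *m C^T *m C'^T]mulmxA -trmx_mul C'C trmx1 mulmx1.
  by rewrite mulmxK // CC'.
rewrite !mulmxA; congr (_ *m _ *m _).
by rewrite -[_ *m C^T *m C'^T]mulmxA -trmx_mul C'C trmx1 mulmx1.
Qed.

End ChangeOfBasis.

(** * Tensor fields in coordinates *)

Section Tensors.
Variables (R : realType) (n : nat) (M : manifold R n).

Lemma coord_field_components (x : M) k q : in_chart x q ->
  components idfun x (coord_field x k) q = delta_mx 0 k.
Proof.
move=> xq; rewrite /components /coord_field /= -row_mul tchangeK //; last first.
  exact: in_chart_refl.
by rewrite rowE mulmx1.
Qed.

Lemma smooth_coord_field (x : M) k : smooth_field_at idfun x (coord_field x k).
Proof.
apply: smooth_fun_congr (smooth_fun_cst (delta_mx 0 k : 'rV[R]_n) x).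
apply: filterS (near_in_chart (in_chart_refl x)) => q xq.
by rewrite coord_field_components.
Qed.

(** The components at [q], in the coordinate basis of the chart at [x], of an
    endomorphism field; likewise below for a 1-form and a metric. Unlike
    the matrices [phi q] themselves, they are smooth in [q] when the tensor field is. *)
Definition endo_at (phi : M -> 'M[R]_n) x q := tchange x q q *m phi q *m tchange q x q.
Definition covec_at (eta : M -> 'cV[R]_n) x q := tchange x q q *m eta q.
Definition metric_at (g : M -> 'M[R]_n) x q :=
  tchange x q q *m g q *m (tchange x q q)^T.

(** The rows are the components of the images of the coordinate fields. *)
Lemma smooth_endo_at phi x :
  (forall X, smooth_field_at idfun x X ->
     smooth_field_at idfun x (fun q => X q *m phi q)) ->
  smooth_fun_at x (endo_at phi x).
Proof.
move=> sphi; apply: smooth_fun_rows => k.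
rewrite (_ : (fun q => _) = components idfun x (fun q => coord_field x k q *m phi q)).
  exact/sphi/smooth_coord_field.
by apply/funext => q; rewrite /endo_at !row_mul.
Qed.

Lemma smooth_covec_at eta x :
  (forall X, smooth_field_at idfun x X ->
     smooth_fun_at x (fun q => covec (eta q) (X q) : R^o)) ->
  smooth_fun_at x (covec_at eta x).
Proof.
move=> seta; apply: smooth_fun_mx => k j; rewrite (ord1 j).
rewrite (_ : (fun q => _) = (fun q => covec (eta q) (coord_field x k q))).
  exact/seta/smooth_coord_field.
by apply/funext => q; rewrite /covec_at /covec /coord_field -row_mul [RHS]mxE.
Qed.

Lemma smooth_metric_at g x :
  (forall X Y, smooth_field_at idfun x X -> smooth_field_at idfun x Y ->
     smooth_fun_at x (fun q => ip (g q) (X q) (Y q) : R^o)) ->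
  smooth_fun_at x (metric_at g x).
Proof.
move=> sg; apply: smooth_fun_mx => k j.
rewrite (_ : (fun q => _) =
    (fun q => ip (g q) (coord_field x k q) (coord_field x j q))).
  by apply: sg; exact: smooth_coord_field.
apply/funext => q; rewrite /metric_at /ip /coord_field -row_mul [LHS]mxE [RHS]mxE.
apply: eq_bigr => a _; congr (_ * _); first by rewrite [RHS]mxE.
by rewrite !mxE.
Qed.

End Tensors.

(** * Vector fields along a map *)

Lemma componentsE (R : realType) m n (S : manifold R m) (M : manifold R n)
    (f : S -> M) p (V : S -> 'rV[R]_n) q :
  components f p V q = V q *m tchange (f q) (f p) (f q).
Proof. exact: erefl. Qed.

Section Along.
Variables (R : realType) (m n : nat) (S : manifold R m) (M : manifold R n).
Variables (f : S -> M).
Hypothesis sf : smooth_map f.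
Implicit Types (p q : S) (V W : S -> 'rV[R]_n) (X : S -> 'rV[R]_m).

Lemma near_charts p :
  \forall q \near p, in_chart p q /\ in_chart (f p) (f q).
Proof.
have n1 := near_in_chart (in_chart_refl p).
have n2 := near_map sf (near_in_chart (in_chart_refl (f p))).
by apply: filterS2 n1 n2.
Qed.

Lemma componentsK p q V : in_chart (f p) (f q) ->
  components f p V q *m tchange (f p) (f q) (f q) = V q.
Proof.
move=> fq; rewrite !componentsE -mulmxA tchangeK ?mulmx1 //; exact: in_chart_refl.
Qed.

Lemma components_self p V : components f p V p = V p.
Proof. by rewrite !componentsE tchange_id ?mulmx1 //; exact: in_chart_refl. Qed.

Lemma smooth_fieldD p V W : smooth_field_at f p V -> smooth_field_at f p W ->
  smooth_field_at f p (fun q => V q + W q).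
Proof.
move=> sV sW; apply: smooth_fun_congr (smooth_funD sV sW).
by apply: filterE => q; rewrite !componentsE mulmxDl.
Qed.

Lemma smooth_fieldB p V W : smooth_field_at f p V -> smooth_field_at f p W ->
  smooth_field_at f p (fun q => V q - W q).
Proof.
move=> sV sW; apply: smooth_fun_congr (smooth_funB sV sW).
by apply: filterE => q; rewrite !componentsE mulmxBl.
Qed.

Lemma smooth_fieldZ p (c : S -> R^o) V : smooth_fun_at p c -> smooth_field_at f p V ->
  smooth_field_at f p (fun q => c q *: V q).
Proof.
move=> sc sV; apply: smooth_fun_congr (smooth_funZ sc sV).
by apply: filterE => q; rewrite !componentsE scalemxAl.
Qed.

Lemma endo_components (phi : M -> 'M[R]_n) p q V : in_chart (f p) (f q) ->
  components f p (fun r => V r *m phi (f r)) q =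
  components f p V q *m endo_at phi (f p) (f q).
Proof.
move=> fq; rewrite /endo_at [RHS]mulmxA [X in _ = X *m _]mulmxA.
rewrite [X in _ = X *m _ *m _](componentsK V fq) componentsE.
exact: erefl.
Qed.

Lemma smooth_endo_along (phi : M -> 'M[R]_n) p V :
  smooth_fun_at (f p) (endo_at phi (f p)) -> smooth_field_at f p V ->
  smooth_field_at f p (fun q => V q *m phi (f q)).
Proof.
move=> sphi sV.
apply: smooth_fun_congr (smooth_fun_mulmx sV (smooth_fun_comp sf sphi)).
by apply: filterS (near_charts p) => q [_ fq]; rewrite endo_components.
Qed.

Lemma smooth_covec_along (eta : M -> 'cV[R]_n) p V :
  smooth_fun_at (f p) (covec_at eta (f p)) -> smooth_field_at f p V ->
  smooth_fun_at p (fun q => covec (eta (f q)) (V q) : R^o).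
Proof.
move=> seta sV.
have := smooth_fun_entry 0 0 (smooth_fun_mulmx sV (smooth_fun_comp sf seta)).
apply: smooth_fun_congr; apply: filterS (near_charts p) => q [_ fq].
by rewrite /covec_at mulmxA (componentsK V fq).
Qed.

Section Metric.
Variable g : M -> 'M[R]_n.
Hypothesis pg : forall x, posdef (g x).
Hypothesis free_f : forall p, row_free (dmap f p).

Lemma tan_projE p : tan_proj g f p = ortho_coord (g (f p)) (dmap f p) *m dmap f p.
Proof. exact: proj_tangent. Qed.

Lemma nor_projE p :
  nor_proj g f p = 1%:M - ortho_coord (g (f p)) (dmap f p) *m dmap f p.
Proof. exact: proj_normal. Qed.

Lemma tan_coordE p : tan_coord g f p = ortho_coord (g (f p)) (dmap f p).
Proof. by rewrite /tan_coord tan_projE mulmxKp. Qed.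

Lemma nor_proj_sub p (v : 'rV[R]_n) :
  v *m nor_proj g f p = v - v *m tan_coord g f p *m dmap f p.
Proof. by rewrite nor_projE tan_coordE mulmxBr mulmx1 mulmxA. Qed.

Lemma nor_proj_normal p (v : 'rV[R]_n) : (v <= normal_space g f p)%MS ->
  v *m nor_proj g f p = v.
Proof.
move/sub_kermxP => v0; rewrite nor_proj_sub tan_coordE ortho_coord_ker //.
by rewrite mul0mx subr0.
Qed.

Lemma nor_proj_tangent p (v : 'rV[R]_m) : v *m dmap f p *m nor_proj g f p = 0.
Proof.
rewrite nor_proj_sub tan_coordE -(mulmxA v (dmap f p) (ortho_coord _ _)).
by rewrite ortho_coordK // mulmx1 subrr.
Qed.

(** Near [p] the Gram formula for the projection holds in the components of the
    charts of [p] and [f p], where all its ingredients are smooth. *)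
Lemma smooth_tan_coord p V : smooth_fun_at (f p) (metric_at g (f p)) ->
  smooth_field_at f p V ->
  smooth_field_at idfun p (fun q => V q *m tan_coord g f q).
Proof.
move=> sg sV.
pose G q := metric_at g (f p) (f q); pose B q := Jac f p (f p) q.
have sG : smooth_fun_at p G by exact: (smooth_fun_comp sf sg).
have sB : smooth_fun_at p B by exact: smooth_fun_Jac.
have BE q : in_chart p q -> in_chart (f p) (f q) ->
    B q = tchange p q q *m dmap f q *m tchange (f q) (f p) (f q).
  move=> pq fq; rewrite dmapE; apply/esym; apply: (Jac_tchange sf) => //;
  exact: in_chart_refl.
have sO : smooth_fun_at p (fun q => ortho_coord (G q) (B q)).
  have sGB := smooth_fun_mulmx sG (smooth_fun_trmx sB).
  apply: smooth_fun_mulmx sGB (smooth_fun_invmx _ _); last first.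
    exact: smooth_fun_mulmx (smooth_fun_mulmx sB sG) (smooth_fun_trmx sB).
  apply: filterS (near_charts p) => q [pq fq]; rewrite BE //.
  apply: gram_base_unit; last exact: gram_unit.
    by apply: tchangeK => //; exact: in_chart_refl.
  by apply: tchangeK => //; exact: in_chart_refl.
apply: smooth_fun_congr (smooth_fun_mulmx sV sO).
apply: filterS (near_charts p) => q [pq fq]; rewrite BE // /G.
rewrite (ortho_coord_base (C' := tchange q p q)); first last.
- exact: gram_unit.
- by apply: tchangeK => //; exact: in_chart_refl.
- by apply: tchangeK => //; exact: in_chart_refl.
rewrite [RHS]componentsE /= tan_coordE -(mulmxA (tchange _ _ _)) mulmxA.
by rewrite (componentsK V fq) mulmxA.
Qed.

End Metric.
End Along.

Lemma deriv_row (R : realType) m (S : manifold R m) a b (u : S -> 'M[R]_(a, b)) p w k :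
  smooth_fun_at p u -> deriv (fun q => row k (u q)) p w = row k (deriv u p w).
Proof.
move=> su; apply/rowP => j; rewrite [RHS]mxE -(deriv_entry w k j su).
have sr : smooth_fun_at p (fun q => row k (u q)).
  apply: smooth_fun_mx => i' j'.
  apply: smooth_fun_congr (smooth_fun_entry k j' su).
  by apply: filterE => q; rewrite mxE.
rewrite -(deriv_entry w 0 j sr).
by apply: deriv_congr (smooth_fun_entry k j su); apply: filterE => q; rewrite mxE.
Qed.

(** * Affine connections *)

Section Connection.
Variables (R : realType) (n : nat) (M : manifold R n).
Variable nabla : forall p : M, 'rV[R]_n -> (M -> 'rV[R]_n) -> 'rV[R]_n.
Hypothesis conn : affine_connection nabla.
Implicit Types (x q : M) (X Y Z : M -> 'rV[R]_n) (v w : 'rV[R]_n).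

Lemma smooth_field_congr x Y Z : (\forall q \near x, Y q = Z q) ->
  smooth_field_at idfun x Y -> smooth_field_at idfun x Z.
Proof.
move=> YZ; apply: smooth_fun_congr; apply: filterS YZ => q E.
by rewrite !componentsE E.
Qed.

(** A connection is local: the difference of the two fields equals its product with
    the indicator function of the set where they differ, a function which is
    smooth at [x] with value and derivative 0 there, so that the Leibniz rule
    applies. *)
Lemma nabla_near x v Y Z : (\forall q \near x, Y q = Z q) ->
  smooth_field_at idfun x Y -> nabla x v Z = nabla x v Y.
Proof.
move=> YZ sY; have [_ nD nZ _] := conn.
have sZ := smooth_field_congr YZ sY.
pose u : M -> R^o := fun q => (Z q != Y q)%:R.
have su : smooth_fun_at x u.
  apply: smooth_fun_congr (smooth_fun_cst (0 : R^o) x).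
  by apply: filterS YZ => q E; rewrite /u E eqxx.
have sW := smooth_fieldB sZ sY.
have YZx := nbhs_singleton YZ.
have W0 : nabla x v (fun q => Z q - Y q) = 0.
  rewrite (_ : (fun q => _) = fun q => u q *: (Z q - Y q)); last first.
    apply/funext => q; rewrite /u; case: eqVneq => [->|_]; last by rewrite scale1r.
    by rewrite scale0r subrr.
  by rewrite nZ // /u YZx eqxx subrr scaler0 scale0r addr0.
rewrite (_ : Z = fun q => Y q + (Z q - Y q)); last first.
  by apply/funext => q; rewrite addrC subrK.
by rewrite nD // W0 addr0.
Qed.

Lemma smooth_field_cst0 x : smooth_field_at idfun x (fun=> 0 : 'rV[R]_n).
Proof.
apply: smooth_fun_congr (smooth_fun_cst (0 : 'rV[R]_n) x).
by apply: filterE => q; rewrite componentsE mul0mx.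
Qed.

Lemma smooth_field_sum x (I : Type) (r : seq I) (u : I -> M -> R^o)
    (Y : I -> M -> 'rV[R]_n) :
  (forall i, smooth_fun_at x (u i)) -> (forall i, smooth_field_at idfun x (Y i)) ->
  smooth_field_at idfun x (fun q => \sum_(i <- r) u i q *: Y i q).
Proof.
move=> su sY; elim: r => [|i r IH].
  by under eq_fun do rewrite big_nil; exact: smooth_field_cst0.
under eq_fun do rewrite big_cons.
by apply: smooth_fieldD => //; exact: smooth_fieldZ.
Qed.

Lemma nabla_sum x v (I : Type) (r : seq I) (u : I -> M -> R^o)
    (Y : I -> M -> 'rV[R]_n) :
  (forall i, smooth_fun_at x (u i)) -> (forall i, smooth_field_at idfun x (Y i)) ->
  nabla x v (fun q => \sum_(i <- r) u i q *: Y i q) =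
  \sum_(i <- r) (deriv (u i) x v *: Y i x + u i x *: nabla x v (Y i)).
Proof.
move=> su sY; have [_ nD nZ _] := conn; elim: r => [|i r IH].
  rewrite big_nil (_ : (fun q => _) = fun q => (0 : R^o) *: (0 : 'rV[R]_n)); last first.
    by apply/funext => q; rewrite big_nil scaler0.
  rewrite (nZ x v (fun=> 0) (fun=> 0) (smooth_fun_cst _ _) (smooth_field_cst0 x)).
  by rewrite scaler0 scale0r addr0.
under eq_fun do rewrite big_cons.
rewrite nD; last exact: smooth_field_sum; last exact: smooth_fieldZ.
by rewrite IH big_cons nZ.
Qed.

(** The connection in the coordinate frame of [chart_at x], whose fields have at [x]
    the components of the standard basis. *)
Lemma nabla_expand x v Y : smooth_field_at idfun x Y ->
  nabla x v Y = deriv (components idfun x Y) x v +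
    \sum_k Y x 0 k *: nabla x v (coord_field x k).
Proof.
move=> sY.
have su k : smooth_fun_at x (fun q => components idfun x Y q 0 k : R^o).
  exact: smooth_fun_entry.
have sE := smooth_coord_field x.
have Yloc : \forall q \near x,
    \sum_k (components idfun x Y q 0 k : R^o) *: coord_field x k q = Y q.
  apply: filterS (near_in_chart (in_chart_refl x)) => q xq.
  by rewrite -(@componentsK _ _ _ M M idfun x q Y xq) mulmx_sum_row.
rewrite (nabla_near v (Z := Y) Yloc); last exact: smooth_field_sum.
rewrite nabla_sum // big_split /=; congr (_ + _).
  rewrite [RHS]row_sum_delta; apply: eq_bigr => k _.
  rewrite (deriv_entry v 0 k sY); congr (_ *: _).
  by rewrite /coord_field tchange_id ?row1 //; exact: in_chart_refl.
by apply: eq_bigr => k _; rewrite components_self.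
Qed.

End Connection.

(** * The connection along a map *)

Section Torsion.
Variables (R : realType) (n : nat) (M : manifold R n) (g : M -> 'M[R]_n).
Variable nabla : forall p : M, 'rV[R]_n -> (M -> 'rV[R]_n) -> 'rV[R]_n.
Hypothesis lc : levi_civita g nabla.

(** Fields with constant components in the chart at [x] have zero bracket, so that
    torsion-freeness is the symmetry of the Christoffel symbols. *)
Lemma coord_torsion_free (x : M) (v w : 'rV[R]_n) :
  \sum_k v 0 k *: nabla x w (coord_field x k) =
  \sum_k w 0 k *: nabla x v (coord_field x k).
Proof.
have [conn tor _] := lc.
(* The field which has constant components u in the chart at x. *)
pose C (u : 'rV[R]_n) (q : M) := u *m tchange x q q.
have Cx u : C u x = u by rewrite /C tchange_id ?mulmx1 //; exact: in_chart_refl.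
have Cloc u : \forall q \near x, u = components idfun x (C u) q.
  apply: filterS (near_in_chart (in_chart_refl x)) => q xq.
  by rewrite componentsE /C /= -mulmxA tchangeK ?mulmx1 //; exact: in_chart_refl.
have sC u : smooth_field_at idfun x (C u).
  exact: smooth_fun_congr (Cloc u) (smooth_fun_cst u x).
have dC u a : deriv (components idfun x (C u)) x a = 0.
  apply: etrans (deriv_congr a (Cloc u) (smooth_fun_cst u x)) _; exact: deriv_cst.
have nC u a : nabla x a (C u) = \sum_k u 0 k *: nabla x a (coord_field x k).
  by rewrite (nabla_expand conn a (sC u)) dC add0r Cx.
rewrite -!nC; have := tor x _ _ (sC w) (sC v).
rewrite /bracket !dC subrr !Cx => /eqP; rewrite subr_eq0 => /eqP; exact.
Qed.

Section AlongMap.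
Variables (m : nat) (S : manifold R m) (f : S -> M).
Hypothesis sf : smooth_map f.

Lemma nabla_alongD (p : S) v (V W : S -> 'rV[R]_n) :
  smooth_field_at f p V -> smooth_field_at f p W ->
  nabla_along nabla f p v (fun q => V q + W q) =
  nabla_along nabla f p v V + nabla_along nabla f p v W.
Proof.
move=> sV sW; rewrite /nabla_along !components_self addrACA -big_split /=.
congr (_ + _); last by apply: eq_bigr => k _; rewrite mxE scalerDl.
apply: etrans (derivD v sV sW); apply: (congr1 (fun u => deriv u p v)).
by apply/funext => q; rewrite !componentsE mulmxDl.
Qed.

(** The derivatives of the components give the push-forward of the bracket by its
    naturality; the Christoffel terms cancel by symmetry. *)
Lemma nabla_along_torsion_free (p : S) (X Y : S -> 'rV[R]_m) :
  smooth_field_at idfun p X -> smooth_field_at idfun p Y ->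
  nabla_along nabla f p (X p) (push f Y) - nabla_along nabla f p (Y p) (push f X) =
  push f (bracket X Y) p.
Proof.
move=> sX sY; rewrite /nabla_along !components_self.
rewrite (coord_torsion_free (f p) (push f Y p) (push f X p)).
by rewrite opprD addrACA subrr addr0 -push_bracket.
Qed.

(** The covariant derivative of [phi] is tensorial, so along [f] it is determined by
    its values on the coordinate fields of the ambient manifold. *)
Lemma nabla_along_endo (phi : M -> 'M[R]_n) (p : S) v (V : S -> 'rV[R]_n) :
  (forall X, smooth_field_at idfun (f p) X ->
     smooth_field_at idfun (f p) (fun q => X q *m phi q)) ->
  smooth_field_at f p V ->
  nabla_along nabla f p v (fun q => V q *m phi (f q)) -
    nabla_along nabla f p v V *m phi (f p) =
  \sum_k V p 0 k *: (
     nabla (f p) (v *m dmap f p) (fun q => coord_field (f p) k q *m phi q) -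
     nabla (f p) (v *m dmap f p) (coord_field (f p) k) *m phi (f p)).
Proof.
move=> sphi sV; have [conn _ _] := lc.
set x := f p; set w := v *m dmap f p.
have sP := smooth_endo_at sphi.
have Px : endo_at phi x x = phi x.
  by rewrite /endo_at !tchange_id ?mulmx1 ?mul1mx //; exact: in_chart_refl.
have nE k : nabla x w (fun q => coord_field x k q *m phi q) =
    row k (deriv (endo_at phi x) x w) +
    \sum_j phi x k j *: nabla x w (coord_field x j).
  rewrite (nabla_expand conn w (sphi _ (smooth_coord_field x k))).
  congr (_ + _).
    apply: etrans (deriv_row w k sP); apply: (congr1 (fun u => deriv u x w)).
    by apply/funext => q; rewrite componentsE /endo_at !row_mul.
  apply: eq_bigr => j _; congr (_ *: _).
  rewrite /coord_field tchange_id ?row1; last exact: in_chart_refl.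
  by rewrite -rowE mxE.
rewrite /nabla_along !components_self.
have -> : deriv (components f p (fun q => V q *m phi (f q))) p v =
    deriv (components f p V) p v *m phi x + V p *m deriv (endo_at phi x) x w.
  have sPf := smooth_fun_comp sf sP.
  have := deriv_mulmx v sV sPf.
  rewrite components_self (deriv_comp sf v sP) -/x -/w Px => <-.
  apply: deriv_congr; last exact: smooth_fun_mulmx sV sPf.
  by apply: filterS (near_charts sf p) => q [_ fq]; rewrite endo_components.
rewrite mulmxDl opprD addrACA [_ + V p *m _]addrC addrK.
under [RHS]eq_bigr do rewrite scalerBr nE scalerDr.
rewrite sumrB big_split /= -mulmx_sum_row -addrA; congr (_ + (_ - _)).
  under [RHS]eq_bigr do rewrite scaler_sumr.
  rewrite exchange_big /=; apply: eq_bigr => j _.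
  rewrite mxE scaler_suml; apply: eq_bigr => k _.
  by rewrite scalerA.
rewrite mulmx_suml; apply: eq_bigr => k _; by rewrite scalemxAl.
Qed.

End AlongMap.
End Torsion.

(** * Partially anti-invariant submanifolds *)

Section PAInv.
Variables (R : realType) (m n : nat) (S : manifold R m) (M : manifold R n).
Variables (g phi : M -> 'M[R]_n) (xi : M -> 'rV[R]_n) (eta : M -> 'cV[R]_n).
Variable (nabla : forall p : M, 'rV[R]_n -> (M -> 'rV[R]_n) -> 'rV[R]_n).
Variables (f : S -> M) (D D' : S -> 'M[R]_m).
Hypothesis hM : kenmotsu g phi xi eta nabla.
Hypothesis hS : PAInv_submanifold g phi xi f D D'.
Implicit Types (p q : S) (X Y : S -> 'rV[R]_m) (V : S -> 'rV[R]_n).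

Let sf : smooth_map f. Proof. by have [[]] := hS. Qed.
Let free_f p : row_free (dmap f p). Proof. by have [[_]] := hS. Qed.
Let pg x : posdef (g x).
Proof. by have [[[_ pos _] _ _] _ _] := hM => u; exact: pos. Qed.

Lemma metric_sym x (u v : 'rV[R]_n) : ip (g x) u v = ip (g x) v u.
Proof. by have [[[sym _ _] _ _] _ _] := hM. Qed.

Lemma metric_phi x (u v : 'rV[R]_n) :
  ip (g x) (u *m phi x) (v *m phi x) = ip (g x) u v - covec (eta x) u * covec (eta x) v.
Proof. by have [[_ _ /(_ x)[_ _ _ _ h]] _ _] := hM; exact: h. Qed.

Lemma phi_xi x : xi x *m phi x = 0.
Proof. by have [[_ _ /(_ x)[_ _ h _ _]] _ _] := hM. Qed.

(** Compatibility of the metric with [phi], applied to [xi], on which [phi]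
    vanishes. *)
Lemma eta_ip x (u : 'rV[R]_n) : covec (eta x) u = ip (g x) u (xi x).
Proof.
have [[_ _ /(_ x)[_ e1 _ _ _]] _ _] := hM.
have := metric_phi x u (xi x); rewrite phi_xi e1 mulr1 /ip trmx0 mulmx0 mxE.
by move/esym/eqP; rewrite subr_eq0 => /eqP.
Qed.

Let smooth_phi_along p V : smooth_field_at f p V ->
  smooth_field_at f p (fun q => V q *m phi (f q)).
Proof.
have [[_ [sphi _ _] _] _ _] := hM.
exact: (smooth_endo_along sf (smooth_endo_at (sphi (f p)))).
Qed.

Lemma xi_tanK p : xi_tan g xi f p *m dmap f p = xi (f p).
Proof.
have [_ xitan _ _ _] := hS.
rewrite /xi_tan; have /submxP[a ->] := xitan p.
by rewrite (tan_coordE pg free_f) -(mulmxA a (dmap f p)) ortho_coordK // mulmx1.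
Qed.

Lemma xi_normal_part p : xi (f p) *m nor_proj g f p = 0.
Proof. by rewrite -xi_tanK nor_proj_tangent. Qed.

Lemma mul_Nmx k (u : 'M[R]_(k, m)) p :
  u *m Nmx g phi f p = u *m dmap f p *m phi (f p) *m nor_proj g f p.
Proof. by rewrite /Nmx mulmxA (mulmxA u). Qed.

Lemma NpartE X p : Npart g phi f X p = push f X p *m phi (f p) *m nor_proj g f p.
Proof. exact: mul_Nmx. Qed.

Lemma push_TpartE X p :
  push f (Tpart g phi f X) p = push f X p *m phi (f p) *m tan_coord g f p *m dmap f p.
Proof. by rewrite /push /Tpart /Tmx !mulmxA. Qed.

Lemma tangent_normal_split X :
  (fun q => push f X q *m phi (f q)) =
  (fun q => push f (Tpart g phi f X) q + Npart g phi f X q).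
Proof.
apply/funext => q; rewrite NpartE push_TpartE (nor_proj_sub pg free_f).
by rewrite addrC subrK.
Qed.

Let smooth_Tpart p X : smooth_field_at idfun p X ->
  smooth_field_at idfun p (Tpart g phi f X).
Proof.
move=> sX; have [[[_ _ sg] _ _] _ _] := hM.
have := smooth_tan_coord sf pg free_f (smooth_metric_at (sg (f p)))
  (smooth_phi_along (smooth_push sf sX)).
apply: smooth_fun_congr; apply: filterE => q.
by rewrite !componentsE /Tpart /Tmx /push /= !mulmxA.
Qed.

Lemma smooth_Npart p X : smooth_field_at idfun p X ->
  smooth_field_at f p (Npart g phi f X).
Proof.
move=> sX.
have := smooth_fieldB (smooth_phi_along (smooth_push sf sX))
  (smooth_push sf (smooth_Tpart sX)).
apply: smooth_fun_congr; apply: filterE => q; rewrite !componentsE.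
by rewrite (congr1 (@^~ q) (tangent_normal_split X)) /= addrC addKr.
Qed.

Lemma smooth_eta_push p X : smooth_field_at idfun p X ->
  smooth_fun_at p (fun q => covec (eta (f q)) (push f X q) : R^o).
Proof.
move=> sX; have [[_ [_ _ seta] _] _ _] := hM.
exact: (smooth_covec_along sf (smooth_covec_at (seta (f p)))) (smooth_push sf sX).
Qed.

Lemma kenmotsu_along p v V : smooth_field_at f p V ->
  nabla_along nabla f p v (fun q => V q *m phi (f q)) =
  nabla_along nabla f p v V *m phi (f p) +
  (ip (g (f p)) (v *m dmap f p *m phi (f p)) (V p) *: xi (f p) -
   covec (eta (f p)) (V p) *: (v *m dmap f p *m phi (f p))).
Proof.
move=> sV; have [[_ [sphi _ _] _] lc ken] := hM.
rewrite -[LHS](subrK (nabla_along nabla f p v V *m phi (f p))) addrC; congr (_ + _).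
rewrite (nabla_along_endo lc sf v (sphi (f p)) sV).
set w := v *m dmap f p; set x := f p.
under eq_bigr do rewrite (ken _ _ _ (smooth_coord_field x _)).
have cE k : coord_field x k x = delta_mx 0 k.
  by rewrite /coord_field tchange_id ?row1 //; exact: in_chart_refl.
have ipE : ip (g x) (w *m phi x) (V p) =
    \sum_k V p 0 k * ip (g x) (w *m phi x) (delta_mx 0 k).
  rewrite {1}[V p]row_sum_delta /ip linear_sum mulmx_sumr summxE.
  by apply: eq_bigr => k _; rewrite linearZ -scalemxAr mxE.
have covE : covec (eta x) (V p) = \sum_k V p 0 k * covec (eta x) (delta_mx 0 k).
  rewrite {1}[V p]row_sum_delta /covec mulmx_suml summxE.
  by apply: eq_bigr => k _; rewrite -scalemxAl mxE.
rewrite ipE covE !scaler_suml -sumrB; apply: eq_bigr => k _.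
by rewrite cE scalerBr !scalerA.
Qed.

(** The normal part of the Kenmotsu identity along [f]; the term in [xi] disappears
    since [xi] is tangent. *)
Lemma gauss_weingarten p X Y : smooth_field_at idfun p Y ->
  second_fundamental_form g nabla f X (Tpart g phi f Y) p +
    normal_connection g nabla f X (Npart g phi f Y) p =
  nabla_along nabla f p (X p) (push f Y) *m phi (f p) *m nor_proj g f p -
  covec (eta (f p)) (push f Y p) *: Npart g phi f X p.
Proof.
move=> sY; rewrite /second_fundamental_form /normal_connection -mulmxDl.
rewrite -(nabla_alongD nabla (X p) (smooth_push sf (smooth_Tpart sY))
  (smooth_Npart sY)).
rewrite -tangent_normal_split (kenmotsu_along _ (smooth_push sf sY)).
rewrite mulmxDl mulmxBl -!scalemxAl xi_normal_part scaler0 sub0r NpartE.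
exact: erefl.
Qed.

Definition integrability_form X Y p : 'rV[R]_n :=
  second_fundamental_form g nabla f X (Tpart g phi f Y) p
  - second_fundamental_form g nabla f Y (Tpart g phi f X) p
  + normal_connection g nabla f X (Npart g phi f Y) p
  - normal_connection g nabla f Y (Npart g phi f X) p.

Lemma integrability_formE X Y p :
  smooth_field_at idfun p X -> smooth_field_at idfun p Y ->
  integrability_form X Y p =
  Npart g phi f (bracket X Y) p -
  covec (eta (f p)) (push f Y p) *: Npart g phi f X p +
  covec (eta (f p)) (push f X p) *: Npart g phi f Y p.
Proof.
move=> sX sY; have [_ lc _] := hM.
have regroup (a b c d : 'rV[R]_n) : a - b + c - d = (a + c) - (b + d).
  by rewrite [a - b + c]addrAC opprD addrA.
have regroup' (a b c d : 'rV[R]_n) : (a - b) - (c - d) = (a - c) - b + d.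
  by rewrite opprB addrA [LHS]addrAC [a - b - c]addrAC.
rewrite /integrability_form regroup (gauss_weingarten X sY) (gauss_weingarten Y sX).
rewrite regroup' -mulmxBl -mulmxBl (nabla_along_torsion_free lc sf sX sY).
rewrite -NpartE; exact: erefl.
Qed.

(** [phi xi = 0], so [xi] contributes nothing. *)
Lemma sub_N_distr p (u : 'rV[R]_m) : (u <= D_plus_xi g xi f D p)%MS ->
  (u *m Nmx g phi f p <= N_distr g phi f D p)%MS.
Proof.
move=> /(submxMr (Nmx g phi f p)) /submx_trans; apply.
rewrite addsmxMr addsmx_sub; apply/andP; split; first exact: submx_refl.
by rewrite mul_Nmx xi_tanK phi_xi mul0mx sub0mx.
Qed.

Lemma phi_anti_invariant_normal p (u : 'rV[R]_m) : (u <= D' p)%MS ->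
  (u *m dmap f p *m phi (f p) <= normal_space g f p)%MS.
Proof.
have [_ _ _ _ /(_ p)[h _]] := hS => uD; apply: submx_trans h.
by rewrite !submxMr.
Qed.

(** [phi] is an isometry off [xi], and the anti-invariant distribution is orthogonal
    to [xi]. *)
Lemma ip_phi_anti_invariant p (u v : 'rV[R]_m) : (u <= D' p)%MS ->
  ip (g (f p)) (u *m dmap f p *m phi (f p)) (v *m dmap f p *m phi (f p)) =
  ip (g (f p)) (u *m dmap f p) (v *m dmap f p).
Proof.
move=> uD; have [_ _ _ [_ _ oxi _] _] := hS.
by rewrite metric_phi eta_ip -xi_tanK (oxi p u _ uD (submx_refl _)) mul0r subr0.
Qed.

(** On the anti-invariant distribution N is phi, and phi u is orthogonal to N D (phi
    preserves the orthogonality of [D] and [D'], and phi u is normal, so the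
    tangential correction is invisible to it) and to mu by definition. A vector of
    N D + mu orthogonal to both summands vanishes, and phi is injective on [D']. *)
Lemma anti_invariant_part_eq0 p (u : 'rV[R]_m) : (u <= D' p)%MS ->
  (u *m Nmx g phi f p <= ND_plus_mu g phi f D D' p)%MS -> u = 0.
Proof.
move=> uD; have [_ _ _ [oDD' _ _ _] _] := hS.
have nor := phi_anti_invariant_normal uD.
set w := u *m dmap f p *m phi (f p) in nor.
have -> : u *m Nmx g phi f p = w.
  by rewrite mul_Nmx (nor_proj_normal pg free_f).
move=> /sub_addsmxP[[a b] /= wE].
have w0 : ip (g (f p)) w w = 0.
  rewrite {2}wE ipDr.
  have -> : ip (g (f p)) w (a *m N_distr g phi f D p) = 0.
    rewrite /N_distr mulmxA; set d := a *m D p.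
    rewrite mul_Nmx (nor_proj_sub pg free_f) ipDr ipNr ip_phi_anti_invariant //.
    rewrite metric_sym oDD' // ?submxMl // add0r.
    apply/eqP; rewrite oppr_eq0 ip_eq0 trmx_mul !mulmxA.
    have /sub_kermxP := nor; rewrite mulmxA => ->.
    by rewrite mul0mx.
  (* What is left is the product of w with the component in mu. *)
  rewrite add0r metric_sym.
  have : (b *m mu_bundle g phi f D D' p <= mu_bundle g phi f D D' p)%MS.
    exact: submxMl.
  rewrite sub_capmx => /andP[_ /sub_kermxP]; set t := b *m _ => t0.
  have /submxP[c ->] : (w <= phi_distr phi f D' p + N_distr g phi f D p)%MS.
    apply: submx_trans (addsmxSl _ _).
    by rewrite /phi_distr /w !submxMr.
  apply/eqP; rewrite ip_eq0 trmx_mul !mulmxA -(mulmxA t) t0.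
  by rewrite mul0mx.
move: w0; rewrite /w ip_phi_anti_invariant // => /(posdef_eq0 (@pg _)) /eqP.
by rewrite mulmx_free_eq0 // => /eqP.
Qed.

(** [b] plays the bracket. The terms in [u1] and [u2] lie in N D; removing from [b]
    its part in D + <xi> leaves a vector of [D'], which must vanish. *)
Lemma sub_ND_plus_mu_bracket p (b u1 u2 : 'rV[R]_m) (c1 c2 : R) :
  (u1 <= D_plus_xi g xi f D p)%MS -> (u2 <= D_plus_xi g xi f D p)%MS ->
  ((b *m Nmx g phi f p - c1 *: (u1 *m Nmx g phi f p) + c2 *: (u2 *m Nmx g phi f p))%R
     <= ND_plus_mu g phi f D D' p)%MS = (b <= D_plus_xi g xi f D p)%MS.
Proof.
move=> u1D u2D.
have NDs (u : 'rV[R]_m) : (u <= D_plus_xi g xi f D p)%MS ->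
    (u *m Nmx g phi f p <= ND_plus_mu g phi f D D' p)%MS.
  by move=> /sub_N_distr /submx_trans; apply; exact: addsmxSl.
apply/idP/idP => [H|bD]; last first.
  by rewrite !addmx_sub ?eqmx_opp ?scalemx_sub ?NDs.
have bN : (b *m Nmx g phi f p <= ND_plus_mu g phi f D D' p)%MS.
  rewrite -[b *m _](addrK (- (c1 *: (u1 *m Nmx g phi f p)) +
    c2 *: (u2 *m Nmx g phi f p))).
  rewrite addrA addmx_sub // eqmx_opp addmx_sub ?eqmx_opp ?scalemx_sub ?NDs //.
have [_ _ _ [_ _ _ full] _] := hS.
have : (b <= D p + D' p + xi_tan g xi f p)%MS by rewrite full submx1.
move=> /sub_addsmxP[[b1 b2] /= bE].
have /sub_addsmxP[[b3 b4] /= b1E] : (b1 *m (D p + D' p)%MS <= D p + D' p)%MS.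
  exact: submxMl.
have bE' : b = (b3 *m D p + b2 *m xi_tan g xi f p) + b4 *m D' p.
  by rewrite bE b1E addrAC.
have inD : ((b3 *m D p + b2 *m xi_tan g xi f p)%R <= D_plus_xi g xi f D p)%MS.
  by apply: addmx_sub_adds; exact: submxMl.
rewrite bE' (@anti_invariant_part_eq0 p (b4 *m D' p)) ?submxMl ?addr0 //.
rewrite (_ : b4 *m D' p = b - (b3 *m D p + b2 *m xi_tan g xi f p)); last first.
  by rewrite bE' addrC addKr.
by rewrite mulmxBl addmx_sub // eqmx_opp NDs.
Qed.

(** Pointwise by [sub_ND_plus_mu_bracket]; the smoothness required of the sections on
    both sides comes from that of the bracket and of N. *)
Lemma integrable_iff :
  integrable_distribution (D_plus_xi g xi f D) <->
  (forall X Y, is_section idfun (D_plus_xi g xi f D) X ->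
     is_section idfun (D_plus_xi g xi f D) Y ->
     is_section f (ND_plus_mu g phi f D D') (integrability_form X Y)).
Proof.
split=> H X Y [sX XD] [sY YD]; split=> p.
- rewrite (_ : integrability_form X Y = fun q => Npart g phi f (bracket X Y) q -
    covec (eta (f q)) (push f Y q) *: Npart g phi f X q +
    covec (eta (f q)) (push f X q) *: Npart g phi f Y q); last first.
    by apply/funext => q; exact: integrability_formE.
  apply: smooth_fieldD; last first.
    exact: smooth_fieldZ (smooth_eta_push (sX p)) (smooth_Npart (sY p)).
  apply: smooth_fieldB; last first.
    exact: smooth_fieldZ (smooth_eta_push (sY p)) (smooth_Npart (sX p)).
  exact: smooth_Npart (smooth_bracket p sX sY).
- rewrite integrability_formE //.
  have [_ bD] := H X Y (conj sX XD) (conj sY YD).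
  by rewrite sub_ND_plus_mu_bracket.
- exact: smooth_bracket.
- have [_ /(_ p)] := H X Y (conj sX XD) (conj sY YD).
  by rewrite integrability_formE // sub_ND_plus_mu_bracket.
Qed.

End PAInv.

Theorem lemma3 (R : realType) (n m : nat)
  (M : manifold R (n.*2).+1) (S : manifold R m)
  (g phi : M -> 'M[R]_((n.*2).+1)) (xi : M -> 'rV[R]_((n.*2).+1))
  (eta : M -> 'cV[R]_((n.*2).+1))
  (nabla : forall p : M, 'rV[R]_((n.*2).+1) -> (M -> 'rV[R]_((n.*2).+1)) ->
     'rV[R]_((n.*2).+1))
  (f : S -> M) (D D' : S -> 'M[R]_m)
  (hM : kenmotsu g phi xi eta nabla)
  (hS : PAInv_submanifold g phi xi f D D') :
  integrable_distribution (D_plus_xi g xi f D) <->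
  (forall Y1 Y2 : S -> 'rV[R]_m,
     is_section idfun (D_plus_xi g xi f D) Y1 ->
     is_section idfun (D_plus_xi g xi f D) Y2 ->
     is_section f (ND_plus_mu g phi f D D') (fun p =>
       second_fundamental_form g nabla f Y1 (Tpart g phi f Y2) p
       - second_fundamental_form g nabla f Y2 (Tpart g phi f Y1) p
       + normal_connection g nabla f Y1 (Npart g phi f Y2) p
       - normal_connection g nabla f Y2 (Npart g phi f Y1) p)).
Proof. exact: (integrable_iff hM hS). Qed.
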